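(* Let $G$ be a Lie group with Lie algebra $\mathfrak g$, let $M$ and $N$ be smooth connected $G$-manifolds, let $f\colon M\to N$ be a smooth $G$-map, and let $o\in M$ be a base point such that $f(o)$ is fixed by $G$. Let $\lambda$ be a $G$-invariant closed 3-form on $N$ and $\zeta$ a $G$-invariant 2-form on $M$ with $d\zeta=f^*\lambda$, and let $\zeta_{(f,\lambda,\zeta)}$ be the associated closed $G$-invariant 2-form on the fiber $P_f$ of $f$. Let $\vartheta\colon\mathfrak g\to\mathcal A^1(N)$ be a $G$-equivariant linear map satisfying the identities $$\delta_G(\lambda)=-d\vartheta,\qquad \delta_G(\zeta)=f^*(\vartheta),\qquad \delta_G(\vartheta)=0.$$ Then, $\vartheta$ being viewed as a $\mathfrak g^*$-valued 1-form on $N$, the map $$\mu_{f,\vartheta}=-\eta(\pi_{f(o)}^*(\vartheta))\circ j_f\colon P_f\to\mathfrak g^*$$ is a $G$-momentum mapping for $\zeta_{(f,\lambda,\zeta)}$, that is, $\mu_{f,\vartheta}$ is $G$-equivariant and $d\mu_{f,\vartheta}=\delta_G(\zeta_{(f,\lambda,\zeta)})$.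
   Context: Notation: $I=[0,1]$; $\mathcal A^*$ denotes differential forms. Path spaces consist of piecewise smooth paths and are treated as differentiable spaces in the sense of Chen; differential forms on them are forms with respect to this structure. $P_{f(o)}(N)$ is the space of piecewise smooth paths $u\colon I\to N$ with $u(0)=f(o)$, and $\pi_{f(o)}\colon P_{f(o)}(N)\to N$, $u\mapsto u(1)$. The fiber of $f$ is $P_f=\{(q,u)\in M\times P_{f(o)}(N): u(1)=f(q)\}$, with projections $\pi_f\colon P_f\to M$, $(q,u)\mapsto q$, and $j_f\colon P_f\to P_{f(o)}(N)$, $(q,u)\mapsto u$. The group $G$ acts on $P_{f(o)}(N)$ and $P_f$ through its actions on $M$ and $N$. Let $\eta\colon\mathcal A^*(P_{f(o)}(N))\to\mathcal A^{*-1}(P_{f(o)}(N))$ be the $G$-equivariant homotopy operator given by integration along the paths which constitute the points of $P_{f(o)}(N)$, so that $d\eta+\eta d=\mathrm{Id}$ (in positive degrees); for a $k$-form $\alpha$ on $N$, $\eta(\pi_{f(o)}^*\alpha)$ at $u$, evaluated on vector fields $\xi_1,\dots,\xi_{k-1}$ along $u$, is $\int_0^1\alpha(\dot u(t),\xi_1(t),\dots,\xi_{k-1}(t))\,dt$. Put $\beta_\lambda=\eta(\pi_{f(o)}^*\lambda)$ and $\zeta_{(f,\lambda,\zeta)}=j_f^*\beta_\lambda-\pi_f^*\zeta$, a closed $G$-invariant 2-form on $P_f$. For a $G$-space $Y$ and $X\in\mathfrak g$, $X_Y$ denotes the associated fundamental vector field on $Y$ and $i_{X_Y}$ contraction with it.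 $\mathcal A^{2j,k}(Y)$ is the space of degree $j$ polynomial maps on $\mathfrak g$ with values in $\mathcal A^k(Y)$, and $\delta_G\colon\mathcal A^{2*,*}(Y)\to\mathcal A^{2*+2,*-1}(Y)$ is given by $(\delta_G(\alpha))(X)=-i_{X_Y}(\alpha(X))$. Ordinary forms are elements of $\mathcal A^{0,*}(Y)$; $\vartheta$ is an element of $\mathcal A^{2,1}(N)$. For a $G$-map $\mu\colon Y\to\mathfrak g^*$, $d\mu$ is regarded as the element $X\mapsto d\langle\mu,X\rangle$ of $\mathcal A^{2,1}(Y)$. A $G$-momentum mapping for a closed $G$-invariant 2-form $\sigma$ on $Y$ (possibly degenerate) is a $G$-equivariant map $\mu\colon Y\to\mathfrak g^*$ with $d\mu=\delta_G(\sigma)$. *)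

(* Defs.v *)
From HB Require Import structures.
From mathcomp Require Import all_boot all_order all_algebra.
From mathcomp Require Import all_classical all_reals all_analysis.
Import numFieldNormedType.Exports.
Import Order.TTheory GRing.Theory Num.Theory.

Set Implicit Arguments.
Unset Strict Implicit.
Unset Printing Implicit Defensive.

Local Open Scope classical_set_scope.
Local Open Scope ring_scope.

(** * Smooth maps between normed spaces *)

Section Smooth.
Variables (R : realType) (V W : normedModType R).
Implicit Types (f g : V -> W) (A : set V).

(* Intended for open A and finite-dimensional V. *)
Fixpoint Ck (k : nat) (f : V -> W) (A : set V) : Prop :=
  if k is k'.+1 then
    (forall x, A x -> differentiable f x) /\
    (forall v, Ck k' (fun x => 'd f x v) A)
  else forall x, A x -> {for x, continuous f}.

Definition smooth_on A f := forall k, Ck k f A.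

Definition smooth_at f x := exists A, [/\ open A, A x & smooth_on A f].

(* Smoothness on a set that need not be open: local smooth extensions. *)
Definition smooth_extension A f x : set (V -> W) :=
  [set g | smooth_at g x /\ \forall y \near x, A y -> g y = f y].

Definition smooth_within A f x := smooth_extension A f x !=set0.

(* When A lies in the closure of its interior, as all the sets used below do,
   the differential at x does not depend on the extension. *)
Definition Dwithin A f x : V -> W := 'd (xget f (smooth_extension A f x)) x.

End Smooth.

(** * Manifolds *)

(* The atlas is indexed by the points of the manifold: [chart q] is a chart
   around q. The tangent space at q is the model space 'rV_n, read through
   [chart q]; likewise below for tangent maps and forms. [chart q] and
   [chart_inv q] are total functions, meaningful on [source q], [target q]. *)
Record manifold (R : realType) := Manifold {
  msort :> topologicalType;
  mdim : nat;
  chart : msort -> msort -> 'rV[R]_mdim;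
  chart_inv : msort -> 'rV[R]_mdim -> msort;
  source : msort -> set msort;
  target : msort -> set 'rV[R]_mdim;
  source_open : forall q, open (source q);
  target_open : forall q, open (target q);
  source_base : forall q, source q q;
  chart_target : forall q p, source q p -> target q (chart q p);
  chart_inv_source : forall q z, target q z -> source q (chart_inv q z);
  chartK : forall q p, source q p -> chart_inv q (chart q p) = p;
  chart_invK : forall q z, target q z -> chart q (chart_inv q z) = z;
  chart_continuous : forall q p, source q p -> {for p, continuous (chart q)};
  chart_inv_continuous :
    forall q z, target q z -> {for z, continuous (chart_inv q)};
  transition_smooth : forall p q,
    smooth_on (target p `&` chart_inv p @^-1` source q)
              (chart q \o chart_inv p);
  manifold_hausdorff : hausdorff_space msort;
  manifold_second_countable : @second_countable msort }.

Section SmoothMaps.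
Variable R : realType.
Implicit Types M N : manifold R.

Definition smooth_map M N (f : M -> N) :=
  continuous f /\
  forall q, smooth_at (chart (f q) \o f \o chart_inv q) (chart q q).

(* Smoothness of f as a map on the product manifold M1 x M2. *)
Definition smooth_map2 M1 M2 N (f : M1 -> M2 -> N) :=
  continuous (fun p : M1 * M2 => f p.1 p.2) /\
  forall p q,
    smooth_at (fun z : 'rV[R]_(mdim M1) * 'rV[R]_(mdim M2) =>
                 chart (f p q) (f (chart_inv p z.1) (chart_inv q z.2)))
              (chart p p, chart q q).

Definition tangent_map M N (f : M -> N) (q : M) :
    'rV[R]_(mdim M) -> 'rV[R]_(mdim N) :=
  'd (chart (f q) \o f \o chart_inv q) (chart q q).

(* Smooth maps from a subset A of a normed space to a manifold. *)
Definition smooth_param (V : normedModType R) M (A : set V) (phi : V -> M) :=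
  forall x, A x ->
    phi y @[y --> within A (nbhs x)] --> phi x /\
    smooth_within A (chart (phi x) \o phi) x.

Definition Dparam (V : normedModType R) M (A : set V) (phi : V -> M) (x : V) :
    V -> 'rV[R]_(mdim M) :=
  Dwithin A (chart (phi x) \o phi) x.

End SmoothMaps.

(** * Differential forms on manifolds *)

Definition vcons (V : Type) k (x : V) (v : 'I_k -> V) : 'I_k.+1 -> V :=
  fun i => if unlift ord0 i is Some j then v j else x.

Section Forms.
Variable R : realType.
Implicit Types M N : manifold R.

Definition dform M k := M -> ('I_k -> 'rV[R]_(mdim M)) -> R.

Definition alternating_multilinear (V : lmodType R) k
    (w : ('I_k -> V) -> R) :=
  (forall i v a x y,
     w [eta v with i |-> a *: x + y] =
     a * w [eta v with i |-> x] + w [eta v with i |-> y]) /\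
  (forall v i j, i != j -> v i = v j -> w v = 0).

(* The expression of w in the chart around q. *)
Definition local_form M k (w : dform M k) (q : M)
    (z : 'rV[R]_(mdim M)) (v : 'I_k -> 'rV[R]_(mdim M)) : R :=
  w (chart_inv q z)
    (fun i => 'd (chart (chart_inv q z) \o chart_inv q) z (v i)).

Definition is_form M k (w : dform M k) :=
  (forall q, alternating_multilinear (w q)) /\
  (forall q v, smooth_on (target q) (fun z => local_form w q z v)).

Definition exterior_d M k (w : dform M k) : dform M k.+1 := fun q v =>
  \sum_(i < k.+1) (-1) ^+ i *
    'd (fun z => local_form w q z (v \o lift i) : R) (chart q q) (v i).

Definition pullback M N (f : M -> N) k (w : dform N k) : dform M k :=
  fun q v => w (f q) (tangent_map f q \o v).

Definition closed_form M k (w : dform M k) := exterior_d w = fun _ _ => 0.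

End Forms.

(** * Lie groups and their actions *)

Record lie_group (R : realType) := LieGroup {
  lg_manifold :> manifold R;
  lg1 : lg_manifold;
  lgM : lg_manifold -> lg_manifold -> lg_manifold;
  lgV : lg_manifold -> lg_manifold;
  lgMA : associative lgM;
  lg1M : left_id lg1 lgM;
  lgVM : left_inverse lg1 lgV lgM;
  lgM_smooth : smooth_map2 lgM;
  lgV_smooth : smooth_map lgV }.

Section LieGroup.
Variables (R : realType) (G : lie_group R).

(* The tangent space at the unit; of the Lie algebra structure only the vector
   space and the adjoint action are used. *)
Definition lie_algebra := 'rV[R]_(mdim G).

Definition Ad (g : G) : lie_algebra -> lie_algebra :=
  tangent_map (fun h : G => lgM (lgM g h) (lgV g)) (lg1 G).

Definition coAd (g : G) (xi : lie_algebra -> R) : lie_algebra -> R :=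
  xi \o Ad (lgV g).

Definition is_action (Y : Type) (a : G -> Y -> Y) :=
  (forall y, a (lg1 G) y = y) /\
  (forall g h y, a (lgM g h) y = a g (a h y)).

Definition smooth_action (M : manifold R) (a : G -> M -> M) :=
  is_action a /\ smooth_map2 a.

Definition invariant_form (M : manifold R) (a : G -> M -> M) k (w : dform M k) :=
  forall g, pullback (a g) w = w.

(* d/dt (exp (t X) q) at t = 0 is the derivative of the orbit map at 1. *)
Definition fundamental_field (M : manifold R) (a : G -> M -> M)
    (X : lie_algebra) (q : M) : 'rV[R]_(mdim M) :=
  tangent_map (fun g : G => a g q) (lg1 G) X.

(* Ordinary forms w are passed to [delta_G] as the constant map X |-> w. *)
Definition delta_G (M : manifold R) (a : G -> M -> M) k
    (alpha : lie_algebra -> dform M k.+1) : lie_algebra -> dform M k :=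
  fun X q v => - alpha X q (vcons (fundamental_field a X q) v).

(* A smooth curve in G through 1 with velocity X. *)
Definition curve (X : lie_algebra) : R -> G :=
  xget (fun=> lg1 G)
    [set c | [/\ smooth_param [set: R] c, c 0 = lg1 G &
                 Dparam [set: R] c 0 1 = X]].

End LieGroup.

(** * Differentiable spaces in the sense of Chen *)

Section Chen.
Variable R : realType.

(* The domains of Chen's plots. *)
Definition convex_region n (U : set 'rV[R]_n) :=
  (forall x y t, U x -> U y -> 0 <= t <= 1 -> U (t *: x + (1 - t) *: y)) /\
  U° !=set0.

(* The points are the elements of [cpoints], a subset of [csort];
   [cplot U phi] means that the restriction of phi to U is a plot. Chen's
   axioms (constant plots, stability under smooth reparametrization) hold for
   the two path spaces below; they are not recorded, since forms, functions
   and their identities only refer to the plots. *)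
Record plot_space := PlotSpace {
  csort :> Type;
  cpoints : set csort;
  cplot : forall n, set 'rV[R]_n -> ('rV[R]_n -> csort) -> Prop }.

(* A form assigns to each plot phi : U -> Y a form on U; its values are
   relevant only when U is a convex region, phi a plot and the base point is
   in U. *)
Definition chen_form (Y : Type) k :=
  forall n, set 'rV[R]_n -> ('rV[R]_n -> Y) ->
    'rV[R]_n -> ('I_k -> 'rV[R]_n) -> R.

Definition chen_eq (Y : plot_space) k (a b : chen_form Y k) :=
  forall n (U : set 'rV[R]_n) (phi : 'rV[R]_n -> Y),
    convex_region U -> cplot U phi ->
    forall x v, U x -> a n U phi x v = b n U phi x v.

Definition chen_smooth (Y : plot_space) (h : Y -> R) :=
  forall n (U : set 'rV[R]_n) (phi : 'rV[R]_n -> Y),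
    convex_region U -> cplot U phi ->
    forall x, U x -> smooth_within U (h \o phi : _ -> R) x.

Definition chen_d (Y : Type) k (a : chen_form Y k) : chen_form Y k.+1 :=
  fun n U phi x v =>
    \sum_(i < k.+1) (-1) ^+ i *
      Dwithin U (fun y => a n U phi y (v \o lift i) : R) x (v i).

(* 0-forms are functions; the value at y is read off the constant plot
   from the zero-dimensional region. *)
Definition of_function (Y : Type) (h : Y -> R) : chen_form Y 0 :=
  fun n U phi x v => h (phi x).

Definition to_function (Y : Type) (a : chen_form Y 0) : Y -> R :=
  fun y => a 0 [set: 'rV[R]_0] (fun=> y) 0 (fun=> 0).

Definition chen_sub (Y : Type) k (a b : chen_form Y k) : chen_form Y k :=
  fun n U phi x v => a n U phi x v - b n U phi x v.

Definition chen_pullback (Y Z : Type) (h : Y -> Z) k (a : chen_form Z k) :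
    chen_form Y k :=
  fun n U phi => a n U (h \o phi).

(* A form on a manifold, as a form on its Chen space (plots: smooth maps). *)
Definition chen_of_form (M : manifold R) k (w : dform M k) : chen_form M k :=
  fun n U phi x v => w (phi x) (Dparam U phi x \o v).

(* Contraction with the fundamental vector field of X: from a plot phi on U
   one forms the plot (s, x) |-> c(s) phi(x) on R x U, where the curve c
   represents X, and evaluates on d/ds and on v at s = 0. The result depends
   only on X, because the plot factors through (g, x) |-> g phi(x). *)
Definition chen_delta_G (G : lie_group R) (Y : Type) (act : G -> Y -> Y) k
    (alpha : lie_algebra G -> chen_form Y k.+1) :
    lie_algebra G -> chen_form Y k :=
  fun X n U phi x v =>
    - alpha X (1 + n)%N
        [set z : 'rV[R]_(1 + n) | U (rsubmx z)]
        (fun z : 'rV[R]_(1 + n) =>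
           act (curve X (lsubmx z ord0 ord0)) (phi (rsubmx z)))
        (row_mx 0 x)
        (vcons (row_mx (const_mx 1) 0) (fun i => row_mx 0 (v i))).

(* Functions Y -> g^* are represented by Y -> (g -> R), with linearity as the
   first clause. *)
Definition momentum_mapping (G : lie_group R) (Y : plot_space)
    (act : G -> Y -> Y) (sigma : chen_form Y 2)
    (mu : Y -> lie_algebra G -> R) :=
  [/\ forall y, cpoints y -> scalar (mu y),
      forall g y, cpoints y -> mu (act g y) = coAd g (mu y),
      forall X, chen_smooth (fun y : Y => mu y X) &
      forall X, chen_eq (Y := Y)
        (chen_d (of_function (fun y => mu y X)))
        (chen_delta_G act (fun=> sigma) X)].

End Chen.

(** * Path spaces and the fiber of a map *)

Section Paths.
Variable R : realType.

Definition unit_interval := {t : R | 0 <= t <= 1}.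

Lemma zero_in_unit_interval : (0 <= (0 : R) <= 1).
Proof. by rewrite lexx ler01. Qed.

Lemma one_in_unit_interval : (0 <= (1 : R) <= 1).
Proof. by rewrite lexx ler01. Qed.

Definition I0 : unit_interval := exist _ 0 zero_in_unit_interval.
Definition I1 : unit_interval := exist _ 1 one_in_unit_interval.

Definition to_unit (t : R) : unit_interval := insubd I0 t.

(* s lists the points t_1 < ... < t_r = 1 of a partition starting at 0. *)
Definition partition01 (s : seq R) := path <%R 0 s /\ last 0 s = 1.

Definition piece (s : seq R) (i : nat) : set R :=
  `[nth 0 (0 :: s) i, nth 0 (0 :: s) i.+1]%classic.

Variable N : manifold R.

Definition piecewise_smooth (u : unit_interval -> N) :=
  exists2 s, partition01 s &
    forall i, (i < size s)%N -> smooth_param (piece s i) (u \o to_unit).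

Definition path_from (p : N) : set (unit_interval -> N) :=
  [set u | piecewise_smooth u /\ u I0 = p].

(* Chen's differentiable structure on a path space: the adjoint U x I -> N is
   smooth on each U x [t_i, t_(i+1)], with one partition for all of U. *)
Definition path_plot (p : N) n (U : set 'rV[R]_n)
    (phi : 'rV[R]_n -> unit_interval -> N) :=
  (forall x, U x -> path_from p (phi x)) /\
  exists2 s, partition01 s &
    forall i, (i < size s)%N ->
      smooth_param (U `*` piece s i)
        (fun z : 'rV[R]_n * R => phi z.1 (to_unit z.2)).

Definition path_space (p : N) : plot_space R :=
  PlotSpace (path_from p) (path_plot p).

Definition velocity (u : unit_interval -> N) (t : R) : 'rV[R]_(mdim N) :=
  'd (fun s : R => chart (u (to_unit t)) (u (to_unit s))) t 1.

(* eta (pi^* alpha), pi the evaluation of paths at 1: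
     v |-> \int_0^1 alpha (u', v_1, ..., v_k) dt,
   where v_i is transported to the vector field t |-> d/dx phi(x)(t) v_i along
   the path u = phi x. The finitely many t at which u is not differentiable do
   not affect the integral. *)
Definition eta_pi k (alpha : dform N k.+1) : chen_form R (unit_interval -> N) k :=
  fun n U phi x v =>
    \int[lebesgue_measure]_(t in `[0, 1])
      alpha (phi x (to_unit t))
        (vcons (velocity (phi x) t)
           (Dparam U (fun y => phi y (to_unit t)) x \o v)).

Variables (M : manifold R) (f : M -> N) (o : M).

Definition fiber_points : set (M * (unit_interval -> N)) :=
  [set p | path_from (f o) p.2 /\ p.2 I1 = f p.1].

Definition fiber_plot n (U : set 'rV[R]_n)
    (phi : 'rV[R]_n -> M * (unit_interval -> N)) :=
  [/\ forall x, U x -> fiber_points (phi x),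
      smooth_param U (fst \o phi) &
      path_plot (f o) U (snd \o phi)].

Definition fiber : plot_space R := PlotSpace fiber_points fiber_plot.

Definition fiber_pi : fiber -> M := fst.
Definition fiber_j : fiber -> path_space (f o) := snd.

Definition fiber_act (G : lie_group R) (aM : G -> M -> M) (aN : G -> N -> N)
    (g : G) (p : fiber) : fiber :=
  (aM g p.1, aN g \o p.2).

Definition zeta_fiber (lam : dform N 3) (zeta : dform M 2) : chen_form R fiber 2 :=
  chen_sub (chen_pullback fiber_j (eta_pi lam))
           (chen_pullback fiber_pi (chen_of_form zeta)).

Definition mu_fiber (G : lie_group R) (theta : lie_algebra G -> dform N 1)
    (p : fiber) (X : lie_algebra G) : R :=
  - to_function (eta_pi (theta X)) (fiber_j p).

End Paths.

(* Main.v *)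
Require Import Defs.
From HB Require Import structures.
From mathcomp Require Import all_boot all_order all_algebra.
From mathcomp Require Import all_classical all_reals all_analysis.
From mathcomp Require Import measurable_realfun ring lra.
Import numFieldNormedType.Exports.
Import Order.TTheory GRing.Theory Num.Theory.

(** Fix X in the Lie algebra and write theta_X for the one-form theta X. On a
path u the function in question is mu(u)(X) = - \int_0^1 theta_X(u').

Why it is a momentum mapping. Let Phi(y, t) be a family of paths, given by a
plot, and let d_v, d_t be the derivatives in the direction v of the parameter
and in time. Schwarz's theorem gives the pointwise identity
  d_v (theta_X(d_t Phi)) = d theta_X(d_v Phi, d_t Phi) + d_t (theta_X(d_v Phi)),
so integration over [0, 1] yields the first variation formula
  d_v \int theta_X(d_t Phi) = \int d theta_X(d_v Phi, d_t Phi) dt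
                             + theta_X(d_v Phi) at t = 1, minus t = 0.
The identity delta_G(lam) = - d theta turns the integrand into
lam(X_N, d_v Phi, d_t Phi) = lam(d_t Phi, X_N, d_v Phi), which is the integrand
of the contraction of eta(lam) with the fundamental field. The term at t = 0
vanishes because all paths start at f o. At t = 1 the path ends at f(q), so the
term is (f^* theta_X)(d_v q) = - zeta(X_M, d_v q) by delta_G(zeta) = f^* theta.
Up to the common sign this is the contraction of zeta_fiber with the
fundamental field. Equivariance is the substitution rule for the integral along
a path together with the equivariance of theta; linearity in X is linearity of
the integral.

What has to be checked analytically. Plots are only piecewise smooth in time,
and smoothness on a region that is not open means local existence of smooth
extensions, one chart at a time. Therefore the first variation formula,
together with the existence of a smooth extension of the integral near the
parameter, is formulated for an arbitrary subinterval ([first_variation]). It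
is additive in the interval ([first_variation_cat]) and holds on short
intervals, where one chart and one extension suffice
([chart_first_variation]); a supremum argument ([partition_induction]) gives it
on [0, 1] ([path_plot_first_variation]). On a short interval the integral over
time of a smooth function is smooth in the parameter ([smooth_at_integral]),
and the pointwise identity is computed in the chart centred at the point
Phi(y, t), the one in which the velocity and the exterior derivative at this
point are defined ([lift_exterior_d]).

The contraction with a fundamental field is taken along the plot
(s, y) |-> c(s) Phi(y), where c is a chosen curve with velocity X. Such a curve
exists ([curveP]), and the derivative of this plot is X_N in the direction s and
the derivative of Phi in the direction y ([Dparam_flow]). *)

Set Implicit Arguments.
Unset Strict Implicit.
Unset Printing Implicit Defensive.
Local Open Scope classical_set_scope.
Local Open Scope ring_scope.

(** * Differentials and maps of class C^k *)

Section Differentials.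
Variables (R : realType).
Implicit Types V W Z : normedModType R.

(** The Landau notation of [differentiable] is replaced by an explicit
estimate, which is the form that integrates well. *)
Lemma is_diff_near_le V W (f : V -> W) (df : {linear V -> W}) x :
  continuous df ->
  (forall e, 0 < e -> \forall h \near (0 : V),
      `|f (h + x) - f x - df h| <= e * `|h|) ->
  is_diff x f df.
Proof.
move=> dfc fdf.
have fo : f \o shift x = cst (f x) + df +o_ (0 : V) id.
  apply/eqaddoP => e e0; apply: filterS (fdf _ e0) => h /=.
  by rewrite !fctE /= opprD addrA.
have dE := diff_unique dfc fo.
by apply: DiffDef => //; apply/diff_locallyP; rewrite dE.
Qed.

Lemma diff_near_le V W (f : V -> W) x e : differentiable f x -> 0 < e ->
  \forall h \near (0 : V), `|f (h + x) - f x - 'd f x h| <= e * `|h|.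
Proof.
move=> /diff_locallyP[_] /eqaddoP /(_ e) h /h; apply: filterS => z /=.
by rewrite !fctE /= opprD addrA.
Qed.

Lemma near_eq_is_diff V W (f g : V -> W) x (df : V -> W) :
  (\forall y \near x, f y = g y) -> is_diff x f df -> is_diff x g df.
Proof.
move=> fg [df1 <-].
apply: is_diff_near_le; first exact: diff_continuous.
move=> e e0; have := diff_near_le df1 e0.
have fg0 : \forall h \near (0 : V), f (h + x) = g (h + x).
  move: fg; rewrite (near_shift 0 x); apply: filterS => h /=.
  by rewrite subr0 addrC.
by apply: filterS2 fg0 => h ->; rewrite (nbhs_singleton fg).
Qed.

(** Only the germ matters; this is what allows a plot to be replaced by its
local extension or by its expression in another chart. *)
Lemma near_eq_diff V W (f g : V -> W) x :
  (\forall y \near x, f y = g y) -> differentiable f x ->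
  differentiable g x /\ ('d f x = 'd g x :> (V -> W)).
Proof.
move=> fg df; have [dg gE] := near_eq_is_diff fg (differentiableP df).
exact: conj dg (esym gE).
Qed.

Lemma Ck_sub V W k (f : V -> W) (A B : set V) :
  B `<=` A -> Ck k f A -> Ck k f B.
Proof.
move=> BA; elim: k f => [|k IH] f /=; first by move=> + x Bx; apply; exact: BA.
by move=> [df dk]; split=> [x /BA/df//|v]; apply: IH.
Qed.

Lemma CkW V W k (f : V -> W) (A : set V) : Ck k.+1 f A -> Ck k f A.
Proof.
elim: k f => [|k IH] f; first by move=> [df _] x Ax; exact/differentiable_continuous/df.
by move=> [df dk]; split=> // v; exact: IH (dk v).
Qed.

(** Openness of A is essential: two functions that agree on A have the same
differentials there only because A is a neighbourhood of its points. *)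
Lemma eq_Ck V W k (f g : V -> W) (A : set V) : open A ->
  (forall x, A x -> f x = g x) -> Ck k f A -> Ck k g A.
Proof.
move=> oA; elim: k f g => [|k IH] f g fg.
  move=> cf x Ax; have nA : \forall y \near x, f y = g y.
    by apply: filterS (open_nbhs_nbhs (conj oA Ax)) => y /fg.
  rewrite /prop_for /continuous_at -(fg _ Ax).
  by apply: cvg_trans (cf x Ax); exact: near_eq_cvg.
move=> [df dk].
have nA x : A x -> \forall y \near x, f y = g y.
  by move=> Ax; apply: filterS (open_nbhs_nbhs (conj oA Ax)) => y /fg.
split=> [x Ax|v]; first by case: (near_eq_diff (nA x Ax) (df x Ax)).
apply: IH (dk v) => x Ax.
by have [_ ->] := near_eq_diff (nA x Ax) (df x Ax).
Qed.

Lemma Ck_diff V W k (f : V -> W) (A : set V) v :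
  Ck k.+1 f A -> Ck k (fun x => 'd f x v) A.
Proof. by move=> [_ fk]; exact: fk. Qed.

Lemma Ck_cst V W k (c : W) (A : set V) : Ck k (cst c) A.
Proof.
elim: k c => [|k IH] c; first by move=> x _; exact: cvg_cst.
split=> [x _|v]; first exact: differentiable_cst.
suff -> : (fun x => 'd (cst c) x v) = cst (0 : W) :> (V -> W) by exact: IH.
by apply/funext => x; rewrite diff_cst.
Qed.

Lemma Ck_linear V W k (l : {linear V -> W}) (A : set V) :
  continuous l -> Ck k l A.
Proof.
move=> lc; case: k => [x _|k]; first exact: lc.
split=> [x _|v]; first exact: linear_differentiable.
suff -> : (fun x => 'd l x v) = cst (l v) :> (V -> W) by exact: Ck_cst.
by apply/funext => x; rewrite diff_lin.
Qed.

Lemma CkD V W k (f g : V -> W) (A : set V) : open A ->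
  Ck k f A -> Ck k g A -> Ck k (fun x => f x + g x) A.
Proof.
move=> oA; elim: k f g => [|k IH] f g.
  by move=> cf cg x Ax; apply: continuousD; [exact: cf|exact: cg].
move=> [df fk] [dg gk]; split=> [x Ax|v].
  by apply: differentiableD; [exact: df|exact: dg].
apply: (eq_Ck (f := fun x => 'd f x v + 'd g x v)) => // [x Ax|].
  exact: esym (congr1 (@^~ v) (diffD (df x Ax) (dg x Ax))).
exact: (IH _ _ (fk v) (gk v)).
Qed.

Lemma Ck_sum V W k n (f : 'I_n -> V -> W) (A : set V) : open A ->
  (forall i, Ck k (f i) A) -> Ck k (fun x => \sum_(i < n) f i x) A.
Proof.
move=> oA; elim: n f => [|n IH] f fk.
  suff -> : (fun x => \sum_(i < 0) f i x) = cst 0 by exact: Ck_cst.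
  by apply/funext => x; rewrite big_ord0.
suff -> : (fun x => \sum_(i < n.+1) f i x) =
    (fun x => f ord0 x + \sum_(i < n) f (lift ord0 i) x).
  exact: (CkD oA (fk ord0) (IH _ (fun i => fk (lift ord0 i)))).
by apply/funext => x; rewrite big_ord_recl.
Qed.

Lemma is_diffZ_fun V W (f : V -> R) (g : V -> W) x :
  differentiable f x -> differentiable g x ->
  is_diff x (fun y => f y *: g y) (fun v => f x *: 'd g x v + 'd f x v *: g x).
Proof.
move=> df dg.
have h : is_diff (f x, g x) (fun q : R * W => q.1 *: q.2)
    (fun q => f x *: q.2 + q.1 *: g x).
  have bl : bilinear_for (GRing.Scale.Law.clone _ _ *:%R _)
      (GRing.Scale.Law.clone _ _ *:%R _) (fun (a : R) (w : W) => a *: w).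
    split=> [u'|u] a b c /=; first by rewrite scalerDl scalerA.
    by rewrite scalerDr !scalerA mulrC.
  pose bM := bilinear_isBilinear.Build R R W W _ _ (fun (a : R) (w : W) => a *: w) bl.
  pose b : {bilinear R -> W -> W} := HB.pack (fun (a : R) (w : W) => a *: w) bM.
  have bc : continuous (fun p => b p.1 p.2).
    by move=> [a w]; exact: scale_continuous.
  apply: DiffDef; first exact: (differentiable_bilin (f := b) (f x, g x) bc).
  exact: (diff_bilin (f := b) (f x, g x) bc).
have hp := @is_diff_pair _ _ _ _ f ('d f x) g ('d g x) x
   (differentiableP df) (differentiableP dg).
exact: (@is_diff_comp _ _ _ _ (fun y => (f y, g y)) _
   (fun q : R * W => q.1 *: q.2) _ x hp h).
Qed.

Lemma CkZ V W k (f : V -> R) (g : V -> W) (A : set V) : open A ->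
  Ck k f A -> Ck k g A -> Ck k (fun x => f x *: g x) A.
Proof.
move=> oA; elim: k f g => [|k IH] f g.
  by move=> cf cg x Ax; apply: cvgZ; [exact: cf|exact: cg].
move=> fk gk; have [df fv] := fk; have [dg gv] := gk.
have dfg x (Ax : A x) := is_diffZ_fun (df x Ax) (dg x Ax).
split=> [x Ax|v]; first by case: (dfg x Ax).
apply: (eq_Ck (f := fun x => f x *: 'd g x v + 'd f x v *: g x)) => //.
  by move=> x Ax; case: (dfg x Ax) => _ ->.
apply: CkD => //; first exact: (IH _ _ (CkW fk) (gv v)).
exact: (IH _ _ (fv v) (CkW gk)).
Qed.

Lemma Ck_pair V W Z k (f : V -> W) (g : V -> Z) (A : set V) : open A ->
  Ck k f A -> Ck k g A -> Ck k (fun x => (f x, g x)) A.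
Proof.
move=> oA; elim: k f g => [|k IH] f g.
  by move=> cf cg x Ax; apply: cvg_pair; [exact: cf|exact: cg].
move=> [df fk] [dg gk]; split=> [x Ax|v].
  by apply: differentiable_pair; [exact: df|exact: dg].
apply: (eq_Ck (f := fun x => ('d f x v, 'd g x v))) => // [x Ax|].
  exact: esym (congr1 (@^~ v) (diff_pair (df x Ax) (dg x Ax))).
exact: (IH _ _ (fk v) (gk v)).
Qed.

End Differentials.

Section NearDiff.
Variables (R : realType) (V W Z : normedModType R).

Lemma near_diff_eq (f g : V -> W) x v : (\forall y \near x, f y = g y) ->
  differentiable f x -> 'd f x v = 'd g x v.
Proof. by move=> fg df; case: (near_eq_diff fg df) => _ /(congr1 (@^~ v)). Qed.

(** Chain rule for a map that is a composition only near the point, as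
happens for all the expressions in charts below. *)
Lemma near_diff_comp (k : V -> Z) (f : V -> W) (g : W -> Z) x v :
  (\forall y \near x, k y = g (f y)) ->
  differentiable f x -> differentiable g (f x) ->
  'd k x v = 'd g (f x) ('d f x v).
Proof.
move=> kgf df dg.
have gfk : \forall y \near x, (g \o f) y = k y.
  by apply: filterS kgf => y ->.
have [_ E] := near_eq_diff gfk (differentiable_comp df dg).
exact: etrans (esym (congr1 (@^~ v) E)) (congr1 (@^~ v) (diff_comp df dg)).
Qed.

Lemma diffN_fun (f : V -> W) x v :
  differentiable f x -> 'd (fun y => - f y) x v = - 'd f x v.
Proof. by move=> df; exact: (congr1 (@^~ v) (diffN df)). Qed.

End NearDiff.

Section ProductSlices.
Variables (R : realType) (V1 V2 W : normedModType R) (G : V1 * V2 -> W).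
Variables (y : V1) (t : V2).
Hypothesis Gs : differentiable G (y, t).

Lemma diff_slicel v : 'd (fun z => G (z, t)) y v = 'd G (y, t) (v, 0).
Proof.
have d1 : is_diff y (fun z : V1 => (z, t)) (fun z => (z, 0)).
  exact: (@is_diff_pair _ _ _ _ id id (cst t) 0 y (is_diff_id y) (is_diff_cst t y)).
transitivity ('d G (y, t) ('d (fun z : V1 => (z, t)) y v)); last by case: d1 => _ ->.
apply: (near_diff_comp (f := fun z : V1 => (z, t)) (g := G)); first exact: filterE.
  by case: d1.
exact: Gs.
Qed.

Lemma diff_slicer v : 'd (fun z => G (y, z)) t v = 'd G (y, t) (0, v).
Proof.
have d1 : is_diff t (fun z : V2 => (y, z)) (fun z => (0, z)).
  exact: (@is_diff_pair _ _ _ _ (cst y) 0 id id t (is_diff_cst y t) (is_diff_id t)).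
transitivity ('d G (y, t) ('d (fun z : V2 => (y, z)) t v)); last by case: d1 => _ ->.
apply: (near_diff_comp (f := fun z : V2 => (y, z)) (g := G)); first exact: filterE.
  by case: d1.
exact: Gs.
Qed.

End ProductSlices.

(** * Composition and germs of smooth maps *)

Section SmoothAt.
Variables (R : realType).
Implicit Types V W Z : normedModType R.

Lemma is_diff_linear_comp V W Z (l : {linear W -> Z}) (f : V -> W) x :
  continuous l -> differentiable f x -> is_diff x (l \o f) (l \o 'd f x).
Proof.
move=> lc df; have := diff_comp df (linear_differentiable (f x) lc).
rewrite (diff_lin (f x) lc) => dE.
by apply: DiffDef => //; apply: differentiable_comp => //; exact: linear_differentiable.
Qed.

Lemma Ck_linear_comp V W Z k (l : {linear W -> Z}) (f : V -> W) (A : set V) :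
  open A -> continuous l -> Ck k f A -> Ck k (l \o f) A.
Proof.
move=> oA lc; elim: k f => [|k IH] f.
  by move=> cf x Ax; apply: continuous_comp; [exact: cf|exact: lc].
move=> [df fv]; split=> [x Ax|v]; first by case: (is_diff_linear_comp lc (df x Ax)).
apply: (eq_Ck oA _ (IH _ (fv v))) => x Ax.
by have [_ ->] := is_diff_linear_comp lc (df x Ax).
Qed.

(** A finite basis with continuous coordinate functions. It makes the C^k
calculus apply uniformly to R, to row vectors and to products of these, where
no common matrix type is available. *)
Definition finite_dim W := exists n (e : 'I_n -> W) (c : 'I_n -> {linear W -> R}),
  (forall i, continuous (c i)) /\ forall w, w = \sum_i c i w *: e i.

Lemma finite_dimR : finite_dim R.
Proof.
exists 1%N, (fun=> 1), (fun=> idfun); split=> [_ x|w]; first exact: cvg_id.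
by rewrite big_ord1 /= [_ *: _]mulr1.
Qed.

Definition coordl n (i : 'I_n) (v : 'rV[R]_n) : R := v ord0 i.

Fact coordl_linear n (i : 'I_n) : linear (coordl i).
Proof. by move=> a u v; rewrite /coordl !mxE. Qed.
HB.instance Definition _ n (i : 'I_n) :=
  GRing.isLinear.Build R 'rV[R]_n R _ (coordl i) (coordl_linear i).

Lemma coordl_continuous n (i : 'I_n) : continuous (coordl i).
Proof. exact: coord_continuous. Qed.

Lemma finite_dim_row n : finite_dim 'rV[R]_n.
Proof.
exists n, (fun i => delta_mx ord0 i), (fun i => coordl i); split=> [i|w].
  exact: coordl_continuous.
by rewrite [LHS]row_sum_delta.
Qed.

Lemma finite_dim_prod V W : finite_dim V -> finite_dim W -> finite_dim (V * W)%type.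
Proof.
move=> [n [e [c [cc cE]]]] [m [e' [c' [cc' cE']]]].
pose E (i : 'I_(n + m)) : V * W :=
  match fintype.split i with inl j => (e j, 0) | inr j => (0, e' j) end.
pose L1 i : {linear (V * W)%type -> R} := (c i \o fst).
pose L2 i : {linear (V * W)%type -> R} := (c' i \o snd).
pose C (i : 'I_(n + m)) : {linear (V * W)%type -> R} :=
  match fintype.split i with inl j => L1 j | inr j => L2 j end.
exists (n + m)%N, E, C; split=> [i|w].
  rewrite /C; case: (fintype.split i) => j.
    by move=> z; apply: (@continuous_comp _ _ _ fst (c j)); [exact: cvg_fst|exact: cc].
  by move=> z; apply: (@continuous_comp _ _ _ snd (c' j)); [exact: cvg_snd|exact: cc'].
rewrite big_split_ord /=.
under eq_bigr => i _ do rewrite /C /E (unsplitK (inl i)) /=.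
under [X in _ = _ + X]eq_bigr => i _ do rewrite /C /E (unsplitK (inr i)) /=.
have h1 : \sum_(i < n) c i w.1 *: (e i, 0 : W) = (w.1, 0).
  rewrite [LHS]surjective_pairing; congr pair.
    by rewrite [RHS](cE w.1) (big_morph fst (id1 := 0) (op1 := +%R)).
  rewrite (big_morph snd (id1 := 0) (op1 := +%R)) // big1 // => i _ /=.
  by rewrite scaler0.
have h2 : \sum_(i < m) c' i w.2 *: (0 : V, e' i) = (0, w.2).
  rewrite [LHS]surjective_pairing; congr pair.
    rewrite (big_morph fst (id1 := 0) (op1 := +%R)) // big1 // => i _ /=.
    by rewrite scaler0.
  by rewrite [RHS](cE' w.2) (big_morph snd (id1 := 0) (op1 := +%R)).
rewrite [X in _ = X + _]h1 [X in _ = _ + X]h2 [LHS]surjective_pairing.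
by congr pair => /=; rewrite ?addr0 ?add0r.
Qed.

(** The induction needs the map y |-> 'd g (f y) ('d f y v) to be of class C^k.
As 'd g is only known to be C^k one direction at a time, the vector 'd f y v is
expanded in a basis of the middle space, which is why that space has to be
finite-dimensional. *)
Lemma Ck_comp V W Z k (f : V -> W) (g : W -> Z) (A : set V) (B : set W) :
  finite_dim W -> open A -> (forall x, A x -> B (f x)) ->
  Ck k f A -> Ck k g B -> Ck k (g \o f) A.
Proof.
move=> [n [e [c [cc cE]]]] oA AB; elim: k f g AB => [|k IH] f g AB.
  by move=> cf cg x Ax; apply: continuous_comp; [exact: cf|exact/cg/AB].
move=> fk gk; have [df fv] := fk; have [dg gv] := gk.
have dgf x (Ax : A x) := diff_comp (df x Ax) (dg _ (AB _ Ax)).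
split=> [x Ax|v]; first by apply: differentiable_comp; [exact: df|exact/dg/AB].
apply: (eq_Ck (f := fun x =>
    \sum_(i < n) (c i \o (fun y => 'd f y v)) x *:
      ((fun w => 'd g w (e i)) \o f) x)) => // [x Ax|].
  rewrite (dgf x Ax) /= {2}(cE ('d f x v)) linear_sum.
  by apply: eq_bigr => i _; rewrite linearZ.
apply: Ck_sum => // i; apply: CkZ => //.
  exact: (Ck_linear_comp oA (cc i) (fv v)).
exact: (IH f (fun w => 'd g w (e i)) AB (CkW fk) (gv (e i))).
Qed.

Lemma smooth_at_diff V W (f : V -> W) x : smooth_at f x -> differentiable f x.
Proof. by move=> [A [_ Ax /(_ 1%N)[df _]]]; exact: df. Qed.

Lemma smooth_at_continuous V W (f : V -> W) x :
  smooth_at f x -> {for x, continuous f}.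
Proof. by move=> /smooth_at_diff/differentiable_continuous. Qed.

Lemma smooth_at_near V W (f : V -> W) x :
  smooth_at f x -> \forall y \near x, smooth_at f y.
Proof.
move=> [A [oA Ax fA]]; apply: filterS (open_nbhs_nbhs (conj oA Ax)) => y Ay.
by exists A.
Qed.

Lemma smooth_at_deriv V W (f : V -> W) x v :
  smooth_at f x -> smooth_at (fun y => 'd f y v) x.
Proof. by move=> [A [oA Ax fA]]; exists A; split=> // k; exact: (Ck_diff v (fA k.+1)). Qed.

Lemma near_open V (P : set V) x : (\forall y \near x, P y) ->
  exists A, [/\ open A, A x & A `<=` P].
Proof.
by move=> Px; have := Px : nbhs x P; rewrite nbhsE => -[A [oA Ax] AP]; exists A.
Qed.

Lemma near_eq_smooth_at V W (f g : V -> W) x :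
  (\forall y \near x, f y = g y) -> smooth_at f x -> smooth_at g x.
Proof.
move=> /near_open[B [oB Bx fg]] [A [oA Ax fA]]; exists (A `&` B).
split=> [||k]; [exact: openI|by []|].
apply: (eq_Ck (openI oA oB) _ (Ck_sub _ (fA k))) => [y [_ /fg]|y []] //.
Qed.

Lemma smooth_at_cst V W (c : W) (x : V) : smooth_at (cst c) x.
Proof. by exists setT; split=> // [|k]; [exact: openT|exact: Ck_cst]. Qed.

Lemma smooth_at_linear V W (l : {linear V -> W}) x :
  continuous l -> smooth_at l x.
Proof. by move=> lc; exists setT; split=> // [|k]; [exact: openT|exact: Ck_linear]. Qed.

Lemma smooth_atD V W (f g : V -> W) x :
  smooth_at f x -> smooth_at g x -> smooth_at (fun y => f y + g y) x.
Proof.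
move=> [A [oA Ax fA]] [B [oB Bx gB]]; exists (A `&` B).
split=> // [|k]; first exact: openI.
by apply: CkD; [exact: openI|apply: Ck_sub (fA k) => y []|apply: Ck_sub (gB k) => y []].
Qed.

Lemma smooth_atZ V W (f : V -> R) (g : V -> W) x :
  smooth_at f x -> smooth_at g x -> smooth_at (fun y => f y *: g y) x.
Proof.
move=> [A [oA Ax fA]] [B [oB Bx gB]]; exists (A `&` B).
split=> // [|k]; first exact: openI.
by apply: CkZ; [exact: openI|apply: Ck_sub (fA k) => y []|apply: Ck_sub (gB k) => y []].
Qed.

Lemma smooth_atN V W (f : V -> W) x :
  smooth_at f x -> smooth_at (fun y => - f y) x.
Proof.
move=> fs; apply: (near_eq_smooth_at (f := fun y => cst (-1 : R) y *: f y)).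
  by apply: filterE => y; rewrite scaleN1r.
by apply: smooth_atZ => //; exact: smooth_at_cst.
Qed.

Lemma smooth_at_sum V W n (f : 'I_n -> V -> W) x :
  (forall i, smooth_at (f i) x) -> smooth_at (fun y => \sum_i f i y) x.
Proof.
elim: n f => [|n IH] f fs.
  suff -> : (fun y => \sum_(i < 0) f i y) = cst 0 by exact: smooth_at_cst.
  by apply/funext => y; rewrite big_ord0.
suff -> : (fun x => \sum_(i < n.+1) f i x) =
    (fun x => f ord0 x + \sum_(i < n) f (lift ord0 i) x).
  by apply: smooth_atD => //; exact: (IH (fun i => f (lift ord0 i))).
by apply/funext => y; rewrite big_ord_recl.
Qed.

Lemma smooth_at_pair V W Z (f : V -> W) (g : V -> Z) x :
  smooth_at f x -> smooth_at g x -> smooth_at (fun y => (f y, g y)) x.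
Proof.
move=> [A [oA Ax fA]] [B [oB Bx gB]]; exists (A `&` B).
split=> // [|k]; first exact: openI.
by apply: Ck_pair; [exact: openI|apply: Ck_sub (fA k) => y []|apply: Ck_sub (gB k) => y []].
Qed.

Lemma smooth_at_comp V W Z (f : V -> W) (g : W -> Z) x : finite_dim W ->
  smooth_at f x -> smooth_at g (f x) -> smooth_at (g \o f) x.
Proof.
move=> fW sf [B [oB Bx gB]].
have /near_open[C [oC Cx CB]] : \forall y \near x, B (f y).
  by apply: (smooth_at_continuous sf); exact: open_nbhs_nbhs.
have [A [oA Ax fA]] := sf.
exists (A `&` C); split=> // [|k]; first exact: openI.
apply: (@Ck_comp _ _ _ _ _ _ _ B) => //; first exact: openI.
  by move=> y [_ /CB].
by apply: Ck_sub (fA k) => y [].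
Qed.

Lemma smooth_at_linear_comp V W Z (l : {linear W -> Z}) (f : V -> W) x :
  continuous l -> smooth_at f x -> smooth_at (l \o f) x.
Proof.
move=> lc [A [oA Ax fA]]; exists A; split=> // k; exact: Ck_linear_comp.
Qed.

Lemma smooth_at_id V (x : V) : smooth_at id x.
Proof. by apply: (@smooth_at_linear _ _ idfun) => y; exact: cvg_id. Qed.

Lemma smooth_at_snd V W (x : V * W) : smooth_at snd x.
Proof.
apply: (@smooth_at_linear _ _ (snd : {linear (V * W)%type -> W})) => y; exact: cvg_snd.
Qed.

End SmoothAt.

(** * Integrals depending smoothly on a parameter *)

Section Lines.
Variables (R : realType).
Implicit Types V W Z : normedModType R.

Lemma is_diff_line V (p v : V) (t : R) :
  is_diff t (fun s : R => p + s *: v) (fun s => s *: v).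
Proof.
have h := is_diffD (is_diff_cst p t) (is_diff_scalel t v).
apply: (is_diff_eq h); apply/funext => s; exact: add0r.
Qed.

Lemma is_diff_along V W (f : V -> W) (p v : V) (t : R) :
  differentiable f (p + t *: v) ->
  is_diff t (fun s : R => f (p + s *: v)) (fun s => s *: 'd f (p + t *: v) v).
Proof.
move=> df; have h := @is_diff_comp _ _ _ _ (fun s : R => p + s *: v) _ f _ t
  (is_diff_line p v t) (differentiableP df).
by apply: (is_diff_eq h); apply/funext => s /=; rewrite linearZ.
Qed.

Lemma is_diff_derive (f : R -> R) (df : R -> R) (t : R) :
  is_diff t f df -> is_derive t 1 f (df 1).
Proof.
move=> [d1 d2]; apply: DeriveDef; first exact: diff_derivable.
by rewrite deriveE // d2.
Qed.

Lemma mean_value_along V (f : V -> R) (p v : V) :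
  (forall t : R, 0 <= t <= 1 -> differentiable f (p + t *: v)) ->
  exists2 c, 0 < c < 1 & f (p + v) - f p = 'd f (p + c *: v) v.
Proof.
move=> df; pose g (s : R) := f (p + s *: v).
have dg (t : R) : 0 <= t <= 1 -> is_diff t g (fun s => s *: 'd f (p + t *: v) v).
  by move=> t01; apply: is_diff_along; exact: df.
have [||c c01 E] := @MVT R g (fun t => 'd f (p + t *: v) v) 0 1 ltr01.
- move=> t; rewrite in_itv /= => /andP[t0 t1].
  have /dg/is_diff_derive : 0 <= t <= 1 by rewrite !ltW.
  by rewrite scale1r.
- apply: continuous_in_subspaceT => t; rewrite inE /= in_itv /= => /dg[+ _].
  exact: differentiable_continuous.
exists c; first by rewrite in_itv in c01.
by move: E; rewrite /g scale1r scale0r addr0 subr0 mulr1.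
Qed.

Lemma linear_continuous V W (l : {linear V -> W}) :
  finite_dim V -> continuous l.
Proof.
move=> [n [e [c [cc cE]]]].
have -> : (l : V -> W) = (fun v => \sum_i c i v *: l (e i)).
  apply/funext => v; rewrite {1}(cE v) linear_sum.
  by apply: eq_bigr => i _; rewrite linearZ.
move=> v; have : Ck 0 (fun v => \sum_i c i v *: l (e i)) setT.
  apply: Ck_sum => [|i]; first exact: openT.
  apply: CkZ; [exact: openT| |exact: Ck_cst].
  by apply: Ck_linear; exact: cc.
by move=> /(_ v); exact.
Qed.

(** Tube lemma: compactness of the segment makes the neighbourhood of x
uniform in s. *)
Lemma tube_segment V (P : V * R -> Prop) (x : V) (a b : R) :
  (forall s, a <= s <= b -> \forall z \near (x, s), P z) ->
  \forall y \near x, forall s : R, a <= s <= b -> P (y, s).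
Proof.
move=> hP.
have /compact_near_coveringP := @segment_compact R a b.
move=> /(_ V (nbhs x) (fun y s => P (y, s)) _) H.
have {}H : \forall y \near x, `[a, b] `<=` (fun s => P (y, s)).
  apply: H => s; rewrite /= in_itv /= => /hP; case=> [[A B] /= [xA sB] AB].
  by exists (B, A) => //= -[s' y] /= [Bs Ay]; exact: (AB (y, s')).
by apply: filterS H => y ab s sab; apply: ab; rewrite /= in_itv.
Qed.

End Lines.

Section ParametricIntegral.
Variables (R : realType) (V : normedModType R) (a b : R).
Hypothesis fV : finite_dim V.
Hypothesis ab : a <= b.
Local Notation mu := lebesgue_measure.
Implicit Types (Z : normedModType R) (h : V * R -> R) (x v : V).

Lemma segment_integrable (k : R -> R) :
  (forall s, a <= s <= b -> {for s, continuous k}) ->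
  mu.-integrable `[a, b] (EFin \o k).
Proof.
move=> kc; apply: continuous_compact_integrable; first exact: segment_compact.
by apply: continuous_in_subspaceT => s; rewrite inE /= in_itv /= => /kc.
Qed.

Lemma smooth_at_slicer Z (f : V * R -> Z) y (s : R) : smooth_at f (y, s) ->
  smooth_at (fun t => f (y, t)) s.
Proof.
move=> fs; apply: (@smooth_at_comp _ _ _ _ (fun t : R => (y, t)) f) => //.
  by apply: finite_dim_prod => //; exact: finite_dimR.
by apply: smooth_at_pair; [exact: smooth_at_cst|exact: smooth_at_id].
Qed.

Lemma smooth_at_slicel Z (f : V * R -> Z) y (s : R) : smooth_at f (y, s) ->
  smooth_at (fun z => f (z, s)) y.
Proof.
move=> fs; apply: (@smooth_at_comp _ _ _ _ (fun z : V => (z, s)) f) => //.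
  by apply: finite_dim_prod => //; exact: finite_dimR.
by apply: smooth_at_pair; [exact: smooth_at_id|exact: smooth_at_cst].
Qed.

(** At the end points of the segment smoothness at (x, s) is still smoothness
on a full neighbourhood; no one-sided derivatives occur. *)
Definition slice_smooth h x := forall s, a <= s <= b -> smooth_at h (x, s).

Lemma slice_smooth_integrable h x : slice_smooth h x ->
  mu.-integrable `[a, b] (EFin \o (fun s => h (x, s))).
Proof.
move=> hx; apply: segment_integrable => s /hx/smooth_at_slicer.
exact: smooth_at_continuous.
Qed.

Lemma slice_smooth_deriv h x w : slice_smooth h x ->
  slice_smooth (fun z => 'd h z w) x.
Proof. by move=> hx s /hx; exact: smooth_at_deriv. Qed.

Lemma slice_smooth_near h x : slice_smooth h x ->
  \forall y \near x, slice_smooth h y.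
Proof. by move=> hx; apply: tube_segment => s /hx; exact: smooth_at_near. Qed.

Lemma finite_dim_coord_bound n (c : 'I_n -> {linear V -> R}) :
  (forall i, continuous (c i)) ->
  exists2 K : R, 0 < K & forall w, \sum_i `|c i w| <= K * `|w|.
Proof.
move=> cc; elim: n c cc => [|n IH] c cc.
  by exists 1 => // w; rewrite big_ord0 mul1r.
have [K K0 HK] := IH _ (fun i => cc (lift ord0 i)).
have [k k0 Hk] := linear_lipschitz (cc ord0).
exists (k + K) => [|w]; first exact: addr_gt0.
by rewrite big_ord_recl mulrDl lerD.
Qed.

(** For the differentials of h at two points this reduces a uniform estimate to
the finitely many directions of a basis. *)
Lemma linear_dist_le n (e : 'I_n -> V) (c : 'I_n -> {linear V -> R})
    (l1 l2 : {linear (V * R)%type -> R}) (B : R) w :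
  (forall v, v = \sum_i c i v *: e i) ->
  (forall i, `|l1 (e i, 0) - l2 (e i, 0)| <= B) ->
  `|l1 (w, 0) - l2 (w, 0)| <= (\sum_i `|c i w|) * B.
Proof.
move=> cE lB.
have lE (l : {linear (V * R)%type -> R}) : l (w, 0) = \sum_i c i w * l (e i, 0).
  transitivity (l (\sum_i c i w *: (e i, 0))).
    congr (l _); rewrite [RHS]surjective_pairing; congr pair.
      by rewrite (big_morph fst (id1 := 0) (op1 := +%R)) // -cE.
    rewrite (big_morph snd (id1 := 0) (op1 := +%R)) // big1 // => i _ /=.
    by rewrite scaler0.
  by rewrite linear_sum; apply: eq_bigr => i _; rewrite linearZ.
rewrite !lE -sumrB (le_trans (ler_norm_sum _ _ _)) // mulr_suml.
by apply: ler_sum => i _; rewrite -mulrBr normrM ler_wpM2l.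
Qed.

Lemma ler_dist_half (p q r e' : R) :
  `|p - q| <= e' / 2 -> `|p - r| <= e' / 2 -> `|q - r| <= e'.
Proof.
move=> pq pr; rewrite (_ : q - r = (p - r) - (p - q)); last by ring.
by rewrite (le_trans (ler_normB _ _)) // (splitr e') lerD.
Qed.

(** Differentiation under the integral sign. By the mean value theorem the
error at time s is ('d h (x + c w, s) - 'd h (x, s)) (w, 0), and by the tube
lemma the difference of the differentials is small on the basis vectors
uniformly in s, so the integrated error is o(w). *)
Lemma diff_integral h x : slice_smooth h x ->
  is_diff x (fun y => \int[mu]_(s in `[a, b]) h (y, s))
    (fun v => \int[mu]_(s in `[a, b]) 'd h (x, s) (v, 0)).
Proof.
move=> hx; have [n [e [c [cc cE]]]] := fV.
have Lint v := slice_smooth_integrable (slice_smooth_deriv (v, 0) hx).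
have Llin : linear (fun v => \int[mu]_(s in `[a, b]) 'd h (x, s) (v, 0)).
  move=> r u v; rewrite [RHS](_ : _ = r * \int[mu]_(s in `[a, b]) 'd h (x, s) (u, 0) +
    \int[mu]_(s in `[a, b]) 'd h (x, s) (v, 0)) //.
  rewrite -RintegralZl // -RintegralD //; last first.
    exact: (integrableZl _ r (Lint u)).
  apply: eq_Rintegral => s _; rewrite -[r * _]/(r *: _) -linearP.
  congr ('d _ _ _); congr pair => /=.
  by rewrite scaler0 addr0.
pose LM := GRing.isLinear.Build _ _ _ _ _ Llin.
pose L : {linear V -> R} := HB.pack
  (fun v => \int[mu]_(s in `[a, b]) 'd h (x, s) (v, 0)) LM.
rewrite -[X in is_diff_def _ _ X]/(L : V -> R).
apply: is_diff_near_le; first exact: linear_continuous.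
move=> eps eps0; have [K K0 HK] := finite_dim_coord_bound cc.
(* The summand 1 keeps the denominator positive when a = b. *)
pose e' := eps / (K * (b - a + 1)).
have ba0 : 0 < b - a + 1 by rewrite ltr_wpDl // subr_ge0.
have e'0 : 0 < e' by rewrite divr_gt0 // mulr_gt0.
have : \forall y \near x, forall s : R, a <= s <= b -> smooth_at h (y, s) /\
    forall i, `|'d h (y, s) (e i, 0) - 'd h (x, s) (e i, 0)| <= e'.
  apply: (tube_segment (P := fun z => smooth_at h z /\
    forall i, `|'d h z (e i, 0) - 'd h (x, z.2) (e i, 0)| <= e')) => s sab.
  apply: filterI; first exact: smooth_at_near (hx _ sab).
  suff : \forall z \near (x, s), forall i,
    `|'d h z (e i, 0) - 'd h (x, z.2) (e i, 0)| <= e' by [].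
  apply: (@filter_forall _ _ (fun i (z : V * R) =>
    `|'d h z (e i, 0) - 'd h (x, z.2) (e i, 0)| <= e') (nbhs (x, s)) _) => i.
  pose g z := 'd h z (e i, 0).
  have gc : {for (x, s), continuous g}.
    exact/smooth_at_continuous/smooth_at_deriv/hx.
  have e2 : 0 < e' / 2 by rewrite divr_gt0.
  have g1 : \forall z \near (x, s), `|g (x, s) - g z| <= e' / 2.
    by have /cvgrPdist_le/(_ _ e2) := gc.
  have g2 : \forall z \near (x, s), `|g (x, s) - g (x, z.2)| <= e' / 2.
    have gc' : {for (x, s), continuous (fun z : V * R => g (x, z.2))}.
      have := @smooth_at_comp _ _ _ _ (fun z : V * R => (x, z.2)) g (x, s).
      move=> /(_ (finite_dim_prod fV (@finite_dimR R))) H.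
      apply/smooth_at_continuous/H; last exact/smooth_at_deriv/hx.
      by apply: smooth_at_pair; [exact: smooth_at_cst|exact: smooth_at_snd].
    by have /cvgrPdist_le/(_ _ e2) := gc'.
  apply: filterS2 g1 g2 => z; exact: ler_dist_half.
move=> /nbhs_ballP[r r0 Hr].
apply/nbhs_ballP; exists r => //= w; rewrite -ball_normE /= sub0r normrN => wr.
(* The ball is convex, so the mean value theorem may be used inside it. *)
have inball t : 0 <= t <= 1 -> ball x r (x + t *: w).
  move=> /andP[t0 t1]; rewrite -ball_normE /= opprD addrA subrr sub0r normrN.
  by rewrite normrZ ger0_norm // (le_lt_trans _ wr) // ler_piMl.
have hw1 : slice_smooth h (w + x).
  move=> s sab; rewrite addrC -[w]scale1r.
  by case: (Hr _ (inball 1 _) s sab) => //; rewrite ler01 lexx.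
have lineE s (t : R) : (x, s) + t *: (w, 0) = (x + t *: w, s).
  by congr pair; rewrite /= scaler0 addr0.
have key s : a <= s <= b ->
    `|h (w + x, s) - h (x, s) - 'd h (x, s) (w, 0)| <= e' * (K * `|w|).
  move=> sab.
  have [|t /andP[t0 t1]] := @mean_value_along R _ h (x, s) (w, 0).
    move=> t t01; have [+ _] := Hr _ (inball t t01) s sab.
    by rewrite lineE => /smooth_at_diff.
  rewrite lineE -[in X in h X - _](scale1r (w, 0)) lineE scale1r [x + w]addrC => ->.
  apply: (le_trans (@linear_dist_le n e c ('d h (x + t *: w, s)) ('d h (x, s)) e' w cE _)).
    move=> i; have [|_ ->//] := Hr _ (inball t _) s sab.
    by rewrite !ltW.
  by rewrite mulrC ler_wpM2l // ltW.
have i1 := slice_smooth_integrable hw1.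
have i2 := slice_smooth_integrable hx.
rewrite /= -RintegralB // -RintegralB //; last first.
  by have := integrableB _ i1 i2; apply.
have i3 : mu.-integrable `[a, b] (EFin \o (fun s : R =>
    h (w + x, s) - h (x, s) - 'd h (x, s) (w, 0))).
  have := integrableB _ (integrableB _ i1 i2) (Lint w); apply => //.
apply: le_trans (le_normr_Rintegral _ i3) _ => //.
apply: (@le_trans _ _ (\int[mu]_(s in `[a, b]) (e' * (K * `|w|)))).
  apply: le_Rintegral => //; first exact: (integrable_norm i3).
  apply: segment_integrable => s _; exact: cst_continuous.
rewrite Rintegral_cst //.
have -> : fine (mu `[a, b]) = b - a.
  by rewrite lebesgue_measure_itv /= lte_fin; case: ltgtP ab => // ->; rewrite subrr.
have -> : e' * (K * `|w|) * (b - a) = (eps * `|w|) * ((b - a) / (b - a + 1)).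
  rewrite /e'; move: (`|w|) (b - a) ba0 => y d d0.
  by field; rewrite !gt_eqF.
have ew : 0 <= eps * `|w| by rewrite mulr_ge0 // ltW.
by rewrite ler_piMr // ler_pdivrMr // mul1r lerDl.
Qed.

(** The differential of the integral is again an integral of the same kind, so
the class C^k propagates by induction. The open set of the parameters y with h
smooth along the whole segment serves for all k at once. *)
Lemma smooth_at_integral h x : slice_smooth h x ->
  smooth_at (fun y => \int[mu]_(s in `[a, b]) h (y, s)) x.
Proof.
move=> hx; exists (slice_smooth h); split => // [|k].
  rewrite openE => y hy; exact: slice_smooth_near.
have oB : open (slice_smooth h).
  rewrite openE => y hy; exact: slice_smooth_near.
suff H (g : V * R -> R) : slice_smooth h `<=` slice_smooth g ->
    Ck k (fun y => \int[mu]_(s in `[a, b]) g (y, s)) (slice_smooth h) by exact: H.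
elim: k g => [|k IH] g hg.
  move=> y hy; case: (diff_integral (hg _ hy)) => + _.
  exact: differentiable_continuous.
split=> [y hy|v]; first by case: (diff_integral (hg _ hy)).
apply: (eq_Ck oB _ (IH (fun z => 'd g z (v, 0)) _)) => y hy.
  by case: (diff_integral (hg _ hy)) => _ ->.
exact: slice_smooth_deriv (hg _ hy).
Qed.

End ParametricIntegral.

(** * Second derivatives and pulled back one-forms *)

Section SecondDerivatives.
Variables (R : realType).
Implicit Types V W Z : normedModType R.
Local Notation mu := lebesgue_measure.

Lemma integral_deriv (k : R -> R) (a b : R) : a <= b ->
  (forall s, a <= s <= b -> smooth_at k s) ->
  \int[mu]_(s in `[a, b]) 'd k s 1 = k b - k a.
Proof.
rewrite le_eqVlt => /predU1P[<- _|ab ks].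
  by rewrite set_itv1 Rintegral_set1 subrr.
have kc s : a <= s <= b -> {for s, continuous k} by move=> /ks/smooth_at_continuous.
rewrite /Rintegral (@continuous_FTC2 R _ k) //=.
- apply: continuous_in_subspaceT => s; rewrite inE /= in_itv /= => /ks.
  by move=> ks'; apply/smooth_at_continuous/smooth_at_deriv/ks'.
- split.
  + move=> s; rewrite in_itv /= => /andP[s1 s2]; apply: diff_derivable.
    by apply/smooth_at_diff/ks; rewrite !ltW.
  + by apply: cvg_at_right_filter; apply: kc; rewrite lexx ltW.
  + by apply: cvg_at_left_filter; apply: kc; rewrite lexx ltW.
- move=> s; rewrite in_itv /= => /andP[s1 s2]; rewrite derive1E'//.
  by apply/smooth_at_diff/ks; rewrite !ltW.
Qed.

Lemma is_diff_shift V W (f : V -> W) (p c : V) : differentiable f (p + c) ->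
  is_diff p (fun y => f (y + c)) ('d f (p + c)).
Proof.
move=> df; have h1 : is_diff p (fun y : V => y + c) id.
  have h := is_diffD (is_diff_id p) (is_diff_cst c p).
  by apply: (is_diff_eq h); apply/funext => v; exact: addr0.
exact: (@is_diff_comp _ _ _ _ (fun y : V => y + c) _ f _ p h1 (differentiableP df)).
Qed.

(** Two applications of the mean value theorem, first to the difference
y |-> f (y + b) - f y in the direction a, then to 'd f in the direction b. *)
Lemma second_difference V (f : V -> R) (p a b : V) :
  (forall t s : R, 0 <= t <= 1 -> 0 <= s <= 1 ->
     smooth_at f (p + t *: a + s *: b)) ->
  exists t s : R, [/\ 0 <= t <= 1, 0 <= s <= 1 &
    f (p + a + b) - f (p + a) - (f (p + b) - f p) =
    'd (fun y => 'd f y a) (p + t *: a + s *: b) b].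
Proof.
move=> fs; pose g y := f (y + b) - f y.
have fs1 (t : R) : 0 <= t <= 1 -> differentiable f (p + t *: a + b).
  by move=> t01; rewrite -[b]scale1r; apply/smooth_at_diff/fs; rewrite ?ler01 ?lexx.
have fs0 (t : R) : 0 <= t <= 1 -> differentiable f (p + t *: a).
  move=> t01; rewrite -[_ + _]addr0 -[0](scale0r b); apply/smooth_at_diff/fs => //.
  by rewrite ler01 lexx.
have dg (t : R) : 0 <= t <= 1 ->
    is_diff (p + t *: a) g
      (fun v => 'd f (p + t *: a + b) v - 'd f (p + t *: a) v).
  by move=> t01; exact: (is_diffB (is_diff_shift (fs1 t t01))
    (differentiableP (fs0 t t01))).
have [t /dg []//|t /andP[t0 t1]] := @mean_value_along R V g p a.
have t01 : 0 <= t <= 1 by rewrite !ltW.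
have [_ ->] := dg t t01; rewrite {1}/g => gE.
have [s' s01|s /andP[s0 s1] sE] :=
  @mean_value_along R V (fun y => 'd f y a) (p + t *: a) b.
  exact/smooth_at_diff/smooth_at_deriv/fs.
exists t, s; split => //; first by rewrite !ltW.
by rewrite gE -sE.
Qed.

(** The second difference over the parallelogram spanned by h a and h b is
symmetric in a and b, and it equals h^2 times either mixed derivative at some
point near p; the mixed derivatives are continuous at p. *)
Lemma schwarz V (f : V -> R) (p a b : V) : smooth_at f p ->
  'd (fun y => 'd f y a) p b = 'd (fun y => 'd f y b) p a.
Proof.
move=> fs; pose D u w y := 'd (fun y => 'd f y u) y w.
have Dc u w : {for p, continuous (D u w)}.
  exact/smooth_at_continuous/smooth_at_deriv/smooth_at_deriv.
apply/eqP; rewrite -subr_eq0 -normr_le0; apply/ler_addgt0Pl => e e0; rewrite addr0.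
rewrite -[X in X <= _]/(`|D a b p - D b a p|).
have e2 : 0 < e / 2 by rewrite divr_gt0.
have /nbhs_ballP[r r0 Hr] : \forall y \near p,
    [/\ smooth_at f y, `|D a b p - D a b y| <= e / 2 &
        `|D b a p - D b a y| <= e / 2].
  have h1 : \forall y \near p, `|D a b p - D a b y| <= e / 2.
    by have /cvgrPdist_le/(_ _ e2) := Dc a b.
  have h2 : \forall y \near p, `|D b a p - D b a y| <= e / 2.
    by have /cvgrPdist_le/(_ _ e2) := Dc b a.
  by apply: filterS3 (smooth_at_near fs) h1 h2.
pose n := `|a| + `|b| + 1.
have n0 : 0 < n by rewrite ltr_wpDl ?addr_ge0.
(* With this h the parallelogram with sides h a and h b stays in the ball. *)
have [h h0 hn] : exists2 h, 0 < h & h * n < r.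
  exists (r / (2 * n)); first by rewrite divr_gt0 // mulr_gt0.
  rewrite invfM mulrA mulfVK ?gt_eqF // ltr_pdivrMr // mulr_natr mulr2n.
  by rewrite ltrDl.
have inball u w t s : `|u| + `|w| < n -> 0 <= t <= 1 -> 0 <= s <= 1 ->
    ball p r (p + t *: (h *: u) + s *: (h *: w)).
  move=> uw /andP[t0 t1] /andP[s0 s1].
  rewrite -ball_normE /= -addrA opprD addrA subrr sub0r normrN.
  rewrite (le_lt_trans (ler_normD _ _)) // !normrZ !ger0_norm // ?(ltW h0) //.
  apply: (@le_lt_trans _ _ (h * (`|u| + `|w|))).
    by rewrite [leRHS]mulrDr lerD // ler_piMl // mulr_ge0 // ltW.
  by apply: lt_trans hn; rewrite ltr_pM2l.
have key u w : `|u| + `|w| < n -> exists2 y, ball p r y &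
    f (p + h *: u + h *: w) - f (p + h *: u) - (f (p + h *: w) - f p) =
    h * h * D u w y.
  move=> uw; have [|t [s [t01 s01 ->]]] :=
    @second_difference V f p (h *: u) (h *: w).
    by move=> t s t01 s01; case: (Hr _ (inball _ _ _ _ uw t01 s01)).
  have B := inball _ _ _ _ uw t01 s01.
  exists (p + t *: (h *: u) + s *: (h *: w)) => //.
  set y := p + _ + _ in B *; have [sy _ _] := Hr _ B.
  rewrite (_ : (fun y => 'd f y (h *: u)) = h *: (fun y => 'd f y u)); last first.
    by apply/funext => z; rewrite linearZ.
  rewrite (diffZ h (smooth_at_diff (smooth_at_deriv u sy))) /=.
  by rewrite linearZ [LHS]scalerA.
have [|y1 B1 E1] := key a b; first by rewrite /n ltrDl.
have [|y2 B2 E2] := key b a; first by rewrite /n [`|b| + _]addrC ltrDl.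
(* Exchanging a and b does not change the second difference. *)
have EE : D a b y1 = D b a y2.
  have hh : h * h != 0 by rewrite mulf_neq0 // gt_eqF.
  apply: (mulfI hh); rewrite -E1 -E2.
  by rewrite -(addrAC p (h *: a) (h *: b)); ring.
have [_ H1 _] := Hr _ B1; have [_ _ H2] := Hr _ B2.
rewrite (_ : _ - _ = (D a b p - D a b y1) - (D b a p - D b a y2)); last first.
  by rewrite EE; ring.
by rewrite (le_trans (ler_normB _ _)) // (splitr e) lerD.
Qed.

Lemma schwarz_row V m (f : V -> 'rV[R]_m) (p a b : V) : smooth_at f p ->
  'd (fun y => 'd f y a) p b = 'd (fun y => 'd f y b) p a.
Proof.
move=> fs; apply/rowP => i.
have cE u w : ('d (fun y => 'd f y u) p w) ord0 i =
    'd (fun y => 'd (coordl i \o f) y u) p w.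
  have su : smooth_at (fun y => 'd f y u) p by exact: smooth_at_deriv.
  have [_ dE] := is_diff_linear_comp (@coordl_continuous R m i) (smooth_at_diff su).
  rewrite -[LHS]/((coordl i \o 'd (fun y => 'd f y u) p) w) -dE.
  suff H : \forall y \near p, (coordl i \o (fun y => 'd f y u)) y =
      'd (coordl i \o f) y u.
    by have [_ ->] := near_eq_diff H (smooth_at_diff
      (smooth_at_linear_comp (@coordl_continuous R m i) su)).
  apply: filterS (smooth_at_near fs) => y sy.
  by have [_ ->] := is_diff_linear_comp (@coordl_continuous R m i) (smooth_at_diff sy).
rewrite !cE; apply: schwarz; apply: smooth_at_linear_comp => //.
exact: coordl_continuous.
Qed.

Section Pairing.
Variables (m : nat) (l : 'rV[R]_m -> 'rV[R]_m -> R).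
Hypothesis llin : forall z, scalar (l z).

Lemma pairing_sum z w : l z w = \sum_i coordl i w *: l z (delta_mx ord0 i).
Proof.
pose LM := GRing.isLinear.Build _ _ _ _ _ (llin z).
pose L : {scalar 'rV[R]_m} := HB.pack (l z) LM.
rewrite {1}(row_sum_delta w) -[LHS]/(L _) linear_sum.
by apply: eq_bigr => i _; rewrite linearZ.
Qed.

(** Here l z is thought of as the value at z of a one-form with smooth
coefficients. *)
Lemma smooth_at_pairing V (g k : V -> 'rV[R]_m) p :
  smooth_at g p -> smooth_at k p -> (forall w, smooth_at (l^~ w) (g p)) ->
  smooth_at (fun y => l (g y) (k y)) p.
Proof.
move=> gs ks ls; under eq_fun do rewrite pairing_sum.
apply: smooth_at_sum => i; apply: smooth_atZ.
  apply: (smooth_at_linear_comp (l := coordl i)) => //; exact: coordl_continuous.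
exact: (smooth_at_comp (@finite_dim_row R m) gs (ls _)).
Qed.

Lemma diff_pairing V (g k : V -> 'rV[R]_m) p v :
  smooth_at g p -> smooth_at k p -> (forall w, smooth_at (l^~ w) (g p)) ->
  'd (fun y => l (g y) (k y)) p v =
  'd (l^~ (k p)) (g p) ('d g p v) + l (g p) ('d k p v).
Proof.
move=> gs ks ls.
have sum_diff (U : normedModType R) n (f : 'I_n -> U -> R) q u :
    (forall i, differentiable (f i) q) ->
    'd (fun y => \sum_i f i y) q u = \sum_i 'd (f i) q u.
  elim: n f => [|n IH] f df.
    rewrite big_ord0 (_ : (fun y => _) = cst 0) ?diff_cst //.
    by apply/funext => y; rewrite big_ord0.
  rewrite (_ : (fun y => _) = f ord0 + (fun y => \sum_i f (lift ord0 i) y)).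
    rewrite diffD //=; last first.
      rewrite (_ : (fun y => _) = \sum_i f (lift ord0 i)).
        exact: differentiable_sum.
      by apply/funext => y; rewrite fct_sumE.
    by rewrite big_ord_recl; congr (_ + _); apply: IH => i; exact: df.
  by apply/funext => y; rewrite big_ord_recl.
have dk i : is_diff p (coordl i \o k) (coordl i \o 'd k p).
  by apply: is_diff_linear_comp; [exact: coordl_continuous|exact: smooth_at_diff].
have dlg i : is_diff p ((l^~ (delta_mx ord0 i)) \o g)
    ('d (l^~ (delta_mx ord0 i)) (g p) \o 'd g p).
  apply: is_diff_comp; apply: differentiableP; exact: smooth_at_diff.
have dt i := is_diffZ_fun (ex_diff (is_diff_def := dk i)) (ex_diff (is_diff_def := dlg i)).
transitivity ('d (fun y => \sum_i (coordl i \o k) y *: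
    ((l^~ (delta_mx ord0 i)) \o g) y) p v).
  by congr ('d _ p v); apply/funext => y; rewrite pairing_sum.
rewrite sum_diff; last by move=> i; case: (dt i).
have -> : (l^~ (k p)) = (fun z => \sum_i coordl i (k p) *: l z (delta_mx ord0 i)).
  by apply/funext => z; rewrite pairing_sum.
rewrite sum_diff; last first.
  by move=> i; apply: differentiableZ; exact: smooth_at_diff.
rewrite pairing_sum -big_split; apply: eq_bigr => i _.
have [_ ->] := dt i; have [_ ->] := dk i; have [_ ->] := dlg i.
by rewrite diffZ; last exact: smooth_at_diff.
Qed.

(** Flat version of d (g^* l) = g^* (d l) for constant vector fields u and v.
The product rule produces on each side one more term with a second derivative
of g, and these two cancel by Schwarz's theorem. *)
Lemma pullback_exterior_d V (g : V -> 'rV[R]_m) p u v :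
  smooth_at g p -> (forall w, smooth_at (l^~ w) (g p)) ->
  'd (fun y => l (g y) ('d g y v)) p u - 'd (fun y => l (g y) ('d g y u)) p v =
  'd (l^~ ('d g p v)) (g p) ('d g p u) - 'd (l^~ ('d g p u)) (g p) ('d g p v).
Proof.
move=> gs ls.
rewrite (diff_pairing u gs (smooth_at_deriv v gs) ls).
rewrite (diff_pairing v gs (smooth_at_deriv u gs) ls).
have cancel (k : 'rV[R]_m -> R) (x y : R) w1 w2 : w1 = w2 ->
    x + k w1 - (y + k w2) = x - y by move=> ->; ring.
exact: cancel (schwarz_row v u gs).
Qed.

End Pairing.

End SecondDerivatives.

(** * Integrals over intervals and partitions *)

Section Intervals.
Variables (R : realType).
Local Notation mu := lebesgue_measure.
Implicit Types (a b c : R) (f g : R -> R).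

(** Velocities are controlled only inside the pieces of a partition; the two
end points do not matter for the integral. *)
Lemma integrable_oo_eq f g a b : (forall s, a < s < b -> f s = g s) ->
  mu.-integrable `[a, b] (EFin \o f) ->
  mu.-integrable `[a, b] (EFin \o g) /\
  \int[mu]_(s in `[a, b]) g s = \int[mu]_(s in `[a, b]) f s.
Proof.
move=> fg /integrableP[/measurable_EFinP mf fi].
have fgE : {in `]a, b[%classic, f =1 g}.
  by move=> s; rewrite inE /= in_itv /= => /fg ->.
have mf' : measurable_fun `]a, b[ f.
  by apply: measurable_funS mf => //; apply: subset_itvW.
have mg' : measurable_fun `]a, b[ g by exact: (eq_measurable_fun _ fgE mf').
have mg : measurable_fun `[a, b] g.
  by apply/measurable_fun_itv_obnd_cbndP/measurable_fun_itv_bndo_bndcP.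
split.
  apply/integrableP; split; first exact/measurable_EFinP.
  rewrite integral_itv_bndoo; last first.
    by apply: measurableT_comp => //; exact/measurable_EFinP.
  rewrite integral_itv_bndoo in fi; last first.
    by apply: measurableT_comp => //; exact/measurable_EFinP.
  apply: le_lt_trans fi; rewrite le_eqVlt; apply/orP; left; apply/eqP.
  by apply: eq_integral => s /fgE /= <-.
have ooE (k : R -> R) : measurable_fun `]a, b[ k ->
    (\int[mu]_(s in `[a, b]) (k s)%:E = \int[mu]_(s in `]a, b[) (k s)%:E)%E.
  move=> mk; apply: (@integral_itv_bndoo R a b (EFin \o k) true false).
  exact/measurable_EFinP.
rewrite /Rintegral; congr fine.
apply: (etrans (ooE g mg')); apply: (etrans _ (esym (ooE f mf'))).
by apply: eq_integral => s /fgE /= <-.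
Qed.

Lemma integrable_itv_cat f a b c : a <= b -> b <= c ->
  mu.-integrable `[a, b] (EFin \o f) -> mu.-integrable `[b, c] (EFin \o f) ->
  mu.-integrable `[a, c] (EFin \o f) /\
  \int[mu]_(s in `[a, c]) f s =
  \int[mu]_(s in `[a, b]) f s + \int[mu]_(s in `[b, c]) f s.
Proof.
move=> ab bc fab fbc.
have fbc' : mu.-integrable `]b, c] (EFin \o f).
  apply: integrableS fbc => // s.
  by rewrite /= !in_itv /= => /andP[/ltW -> ->].
have U : `[a, c]%classic = `[a, b] `|` `]b, c].
  by rewrite -itv_bndbnd_setU // bnd_simp.
have fac : mu.-integrable `[a, c] (EFin \o f).
  have /integrableP[m1 i1] := fab; have /integrableP[m2 i2] := fbc'.
  have mU : measurable_fun (`[a, b] `|` `]b, c]) f.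
    by apply/measurable_funU => //; split; exact/measurable_EFinP.
  apply/integrableP; rewrite U; split; first exact/measurable_EFinP.
  rewrite ge0_integral_setU //; first exact: lte_add_pinfty.
    by apply: measurableT_comp => //; exact/measurable_EFinP.
  rewrite disj_set2E; apply/eqP/seteqP; split => // s [] /=.
  by rewrite !in_itv /= => /andP[_ sb] /andP[]; rewrite ltNge sb.
split => //; apply/eqP; rewrite addrC -subr_eq.
by rewrite Rintegral_itvB ?bnd_simp // Rintegral_itv_obnd_cbnd.
Qed.

(** Consider the supremum of the x with P a x: by locality there, x can be pushed
beyond it, unless the supremum is b. *)
Lemma interval_induction (P : R -> R -> Prop) a b : a <= b ->
  (forall x y z, x <= y -> y <= z -> P x y -> P y z -> P x z) ->
  (forall s, a <= s <= b -> exists2 e, 0 < e &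
     forall x y, a <= x -> x <= y -> y <= b -> `|x - s| < e -> `|y - s| < e -> P x y) ->
  P a b.
Proof.
move=> ab Pcat Ploc; pose S := [set x | a <= x <= b /\ P a x].
have Sa : S a.
  have [|e e0 Pe] := Ploc a; first by rewrite lexx.
  by split; [rewrite lexx|apply: Pe; rewrite // subrr normr0].
have Sub : ubound S b by move=> x [/andP[]].
have hS : has_sup S by split; [exists a|exists b].
have ac : a <= sup S by apply: sup_upper_bound.
have cb : sup S <= b by apply: ge_sup; [exists a|].
have [|e e0 Pe] := Ploc (sup S); first by rewrite ac.
have [x [/andP[ax xb] Pax] xc] := sup_adherent e0 hS.
have xS : x <= sup S by apply: sup_upper_bound => //; split; rewrite ?ax.
pose y := Num.min b (sup S + e / 2).
have cy : sup S <= y by rewrite le_min cb lerDl divr_ge0 // ltW.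
have yb : y <= b by rewrite ge_min lexx.
have yc : y <= sup S + e / 2 by rewrite ge_min lexx orbT.
have e2 : e / 2 < e by rewrite ltr_pdivrMr // mulr_natr mulr2n ltrDl.
have Pay : P a y.
  apply: (Pcat a x y) => //; first exact: le_trans cy.
  apply: Pe => //; first exact: le_trans cy.
    by rewrite distrC ger0_norm ?subr_ge0 // ltrBlDl -ltrBlDr.
  by rewrite ger0_norm ?subr_ge0 // ltrBlDl (le_lt_trans yc) // ltrD2l.
have Sy : S y by split => //; rewrite yb (le_trans ac).
have yS : y <= sup S by exact: sup_upper_bound.
have : y = b.
  move: yS; rewrite /y; case: (leP b (sup S + e / 2)) => // _.
  by rewrite gerDl leNgt divr_gt0.
by move=> <-.
Qed.

Lemma path_le_last a (s : seq R) : path <%R a s -> a <= last a s.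
Proof.
elim: s a => //= b s IH a /andP[ab /IH]; apply: le_trans; exact: ltW.
Qed.

(** Here the short intervals are only required inside a single piece of the
partition, because plots on path spaces are smooth piece by piece. *)
Lemma partition_induction (P : R -> R -> Prop) (s : seq R) : partition01 s ->
  (forall x y z, x <= y -> y <= z -> P x y -> P y z -> P x z) ->
  (forall i, (i < size s)%N -> forall t, piece s i t -> exists2 e, 0 < e &
     forall x y, piece s i x -> piece s i y -> x <= y ->
       `|x - t| < e -> `|y - t| < e -> P x y) ->
  P 0 1.
Proof.
move=> [ps ls] Pcat Ploc.
have s0 : s != [::] by case: s ls {ps Ploc} => //= /eqP; rewrite eq_sym oner_eq0.
have {Ploc} Pi i : (i < size s)%N -> P (nth 0 (0 :: s) i) (nth 0 (0 :: s) i.+1).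
  move=> si; have := Ploc i si; rewrite /piece.
  have : nth 0 (0 :: s) i < nth 0 (0 :: s) i.+1.
    by move: ps => /(pathP 0)/(_ i si).
  move: (nth _ _ i) (nth _ _ i.+1) => x y xy H.
  apply: interval_induction => //; first exact: ltW.
  move=> t txy; have [|e e0 He] := H t; first by rewrite /= in_itv.
  exists e => // u v xu uv vy; apply: He => //; rewrite /= in_itv /=.
    by rewrite xu (le_trans uv).
  by rewrite vy (le_trans xu).
(* The left end point is generalized, but not the default value of nth. *)
rewrite -[X in P _ X]ls; move: ps s0 Pi {ls}; move: {1 3 5 6 7}0.
elim: s => // y s IH x /= /andP[xy ps] _ Pi.
have Pxy : P x y := Pi 0%N isT.
case: s => [//|z s] in IH ps Pi *.
apply: (Pcat x y) => //; [exact: ltW|exact: path_le_last|].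
by apply: IH => // i si; exact: (Pi i.+1 si).
Qed.

Lemma piece_cover (s : seq R) t : partition01 s -> 0 <= t <= 1 ->
  exists2 i, (i < size s)%N & piece s i t.
Proof.
move=> [ps ls].
have s0 : s != [::] by case: s ls {ps} => //= /eqP; rewrite eq_sym oner_eq0.
rewrite -[X in t <= X]ls /piece.
(* As before, the default value of nth is not generalized. *)
move: ps s0 {ls}; move: {1 2 3 5 7}0.
elim: s => // y s IH x /= /andP[xy ps] _ /andP[xt tl].
have [ty|yt] := leP t y; first by exists 0%N => //=; rewrite in_itv /= xt.
case: s => [|z s] in IH ps tl *; first by rewrite /= leNgt yt in tl.
have [|i si it] := IH _ ps isT; first by rewrite tl ltW.
by exists i.+1.
Qed.

Lemma piece_sub01 (s : seq R) i t : partition01 s -> (i < size s)%N ->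
  piece s i t -> 0 <= t <= 1.
Proof.
move=> [ps ls] si; rewrite /piece /= in_itv /= => /andP[h1 h2].
have sorted_s : sorted <=%R (0 :: s) by apply: (sub_path _ ps) => x y /ltW.
have mono j k : (j <= k)%N -> (k <= size s)%N -> nth 0 (0 :: s) j <= nth 0 (0 :: s) k.
  move=> jk ks; apply: (sorted_leq_nth le_trans le_refl 0 sorted_s) => //.
  exact: (leq_trans jk ks).
rewrite (le_trans (mono 0%N i _ _) h1) ?(ltnW si) //=.
apply: (le_trans h2); rewrite -ls (last_nth 0); exact: (mono i.+1 (size s)).
Qed.

End Intervals.

(** * Charts and forms in charts *)

Lemma vcons0 (V : Type) k (x : V) (v : 'I_k -> V) : vcons x v ord0 = x.
Proof. by rewrite /vcons unlift_none. Qed.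

Lemma vconsS (V : Type) k (x : V) (v : 'I_k -> V) j : vcons x v (lift ord0 j) = v j.
Proof. by rewrite /vcons liftK. Qed.

Lemma vcons_nil (V : Type) (x : V) (v : 'I_0 -> V) : vcons x v = (fun=> x).
Proof. by apply/funext => i; rewrite (ord1 i) vcons0. Qed.

Section Charts.
Variables (R : realType) (M : manifold R).
Implicit Types (p q r : M) (z : 'rV[R]_(mdim M)).

Lemma near_target q z : target q z -> \forall y \near z, target q y.
Proof. by move=> tz; exact: (@open_nbhs_nbhs _ z (target q) (conj (@target_open _ _ q) tz)). Qed.

Lemma near_source q p : source q p -> \forall m \near p, source q m.
Proof. by move=> sp; exact: (@open_nbhs_nbhs _ p (source q) (conj (@source_open _ _ q) sp)). Qed.

Lemma near_chart_inv_source p q z : target p z -> source q (chart_inv p z) ->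
  \forall y \near z, target p y /\ source q (chart_inv p y).
Proof.
move=> tz sz; apply: filterI; first exact: near_target.
exact: (chart_inv_continuous tz (near_source sz)).
Qed.

Lemma transition_smooth_at p q z : target p z -> source q (chart_inv p z) ->
  smooth_at (chart q \o chart_inv p) z.
Proof.
move=> tz sz; exists (target p `&` chart_inv p @^-1` source q); split => //.
  rewrite openE => y [ty sy]; exact: near_chart_inv_source.
exact: transition_smooth.
Qed.

Lemma diff_transition_comp p q r z w : target p z ->
  source q (chart_inv p z) -> source r (chart_inv p z) ->
  'd (chart r \o chart_inv p) z w =
  'd (chart r \o chart_inv q) (chart q (chart_inv p z))
     ('d (chart q \o chart_inv p) z w).
Proof.
move=> tz sq sr.
have tq : target q (chart q (chart_inv p z)) by exact: chart_target.
have s1 := smooth_at_diff (transition_smooth_at tz sq).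
have s2 : differentiable (chart r \o chart_inv q) (chart q (chart_inv p z)).
  by apply/smooth_at_diff/transition_smooth_at => //; rewrite chartK.
apply: (near_diff_comp (f := chart q \o chart_inv p) (g := chart r \o chart_inv q)
  w _ s1 s2).
apply: filterS (near_chart_inv_source tz sq) => y [ty sy] /=.
by rewrite (chartK sy).
Qed.

Lemma diff_chartK q w : 'd (chart q \o chart_inv q) (chart q q) w = w.
Proof.
have sq := source_base q.
have tq : target q (chart q q) by exact: chart_target.
have H : \forall y \near chart q q, id y = (chart q \o chart_inv q) y.
  by apply: filterS (near_target tq) => y ty; rewrite /= chart_invK.
by case: (near_eq_is_diff H (is_diff_id _)) => _ ->.
Qed.

Lemma local_form_transition k (th : dform M k) p q z v : target p z ->
  source q (chart_inv p z) ->
  local_form th p z v =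
  local_form th q (chart q (chart_inv p z))
    (fun i => 'd (chart q \o chart_inv p) z (v i)).
Proof.
move=> tz sz; rewrite /local_form (chartK sz); congr (th _ _).
apply/funext => i; apply: diff_transition_comp => //; exact: source_base.
Qed.

Lemma local_form_chart k (th : dform M k) p m v : source p m ->
  local_form th p (chart p m) v =
  th m (fun i => 'd (chart m \o chart_inv p) (chart p m) (v i)).
Proof. by move=> sm; rewrite /local_form (chartK sm). Qed.

Section OneForms.
Variable th : dform M 1.
Hypothesis thF : is_form th.

(** Vectors replace functions on 'I_1, which makes linearity in the argument
expressible by [scalar]. *)
Definition local_form1 p z w := local_form th p z (fun=> w).

Lemma form1_linear q : scalar (fun w => th q (fun=> w)).
Proof.
case: thF => [/(_ q)[ml _] _] a x y.
have E w : [eta (fun=> 0) with ord0 |-> w] = (fun=> w) :> ('I_1 -> 'rV[R]_(mdim M)).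
  by apply/funext => i; rewrite (ord1 i).
by have := ml ord0 (fun=> 0) a x y; rewrite !E.
Qed.

Lemma local_form1_linear p z : scalar (local_form1 p z).
Proof.
move=> a x y; rewrite /local_form1 /local_form linearP; exact: form1_linear.
Qed.

Lemma local_form1_smooth p z w : target p z -> smooth_at (local_form1 p ^~ w) z.
Proof.
move=> tz; exists (target p); split => //; first exact: target_open.
by case: thF => _; exact.
Qed.

Lemma exterior_d1 q a b :
  exterior_d th q (vcons a (fun=> b)) =
  'd (local_form1 q ^~ b) (chart q q) a - 'd (local_form1 q ^~ a) (chart q q) b.
Proof.
rewrite /exterior_d big_ord_recl big_ord1 expr0 mul1r expr1 mulN1r.
congr (_ - _).
  rewrite vcons0; congr ('d _ _ a); apply/funext => z.
  by congr (local_form _ _ _ _); apply/funext => i /=; rewrite vconsS.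
rewrite vconsS; congr ('d _ _ b); apply/funext => z.
congr (local_form _ _ _ _); apply/funext => i /=; rewrite (ord1 i).
by rewrite (_ : lift _ _ = ord0) ?vcons0 //; apply/val_inj.
Qed.

End OneForms.
End Charts.

(** * Derivatives of plots *)

Section ConvexRegions.
Variables (R : realType) (n : nat) (U : set 'rV[R]_n).
Hypothesis Uc : convex_region U.
Implicit Types (W : normedModType R).

(** From x one sees every point y of the convex region along a segment, so the
differential vanishes on all y - x; because the region has interior points,
these directions span. *)
Lemma diff_eq0_on_region W (h : 'rV[R]_n -> W) x : U x ->
  differentiable h x -> (\forall y \near x, U y -> h y = 0) ->
  forall v, 'd h x v = 0.
Proof.
move=> Ux dh h0.
have dir y : U y -> 'd h x (y - x) = 0.
  move=> Uy; apply/eqP; rewrite -normr_le0; apply/ler_addgt0Pl => e e0.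
  rewrite addr0; set w := y - x.
  pose e' := e / (`|w| + 1).
  have w1 : 0 < `|w| + 1 by rewrite ltr_wpDl.
  have e'0 : 0 < e' by rewrite divr_gt0.
  have N1 : \forall t \near (0 : R), `|h (t *: w + x) - h x - 'd h x (t *: w)|
      <= e' * `|t *: w|.
    have : (fun t : R => t *: w) @ (0 : R) --> (0 : 'rV[R]_n).
      rewrite -[X in _ --> X](scale0r w).
      by apply: cvgZr_tmp; exact: cvg_id.
    by move=> /(_ _ (diff_near_le dh e'0)).
  have N2 : \forall t \near (0 : R), U (t *: w + x) -> h (t *: w + x) = 0.
    have : (fun t : R => t *: w + x) @ (0 : R) --> x.
      have {2}<- : 0 *: w + x = x by rewrite scale0r add0r.
      by apply: cvgD; [apply: cvgZr_tmp; exact: cvg_id|exact: cvg_cst].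
    by move=> /(_ _ h0).
  have /nbhs_ballP[r r0 Hr] : \forall t \near (0 : R),
      (`|h (t *: w + x) - h x - 'd h x (t *: w)| <= e' * `|t *: w|) /\
      (U (t *: w + x) -> h (t *: w + x) = 0) by exact: filterI.
  (* The point x + t (y - x) lies both on the segment, hence in U, and near x. *)
  pose t := Num.min 1 (r / 2).
  have t0 : 0 < t by rewrite lt_min ltr01 divr_gt0.
  have t1 : t <= 1 by rewrite ge_min lexx.
  have tr : t < r.
    rewrite gt_min; apply/orP; right.
    by rewrite ltr_pdivrMr // mulr_natr mulr2n ltrDl.
  have [|H1 H2] := Hr t; first by rewrite -ball_normE /= sub0r normrN gtr0_norm.
  have Ut : U (t *: w + x).
    rewrite (_ : t *: w + x = t *: y + (1 - t) *: x); last first.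
      by rewrite /w scalerBr scalerBl scale1r -addrA [- _ + x]addrC.
    by apply: Uc.1 => //; rewrite t1 ltW.
  rewrite (H2 Ut) (nbhs_singleton h0 Ux) subrr sub0r normrN linearZ /= !normrZ in H1.
  rewrite mulrCA ler_pM2l ?normr_gt0 ?gt_eqF // in H1.
  apply: (le_trans H1); rewrite /e' mulrAC ler_pdivrMr // ler_wpM2l ?ltW //.
  by rewrite ltrDl.
case: Uc => _ [y0 /= y0U] v.
have Uy0 : U y0 by exact: nbhs_singleton y0U.
have N : \forall t \near (0 : R), U (y0 + t *: v).
  have : (fun t : R => y0 + t *: v) @ (0 : R) --> y0.
    have {2}<- : y0 + 0 *: v = y0 by rewrite scale0r addr0.
    by apply: cvgD; [exact: cvg_cst|apply: cvgZr_tmp; exact: cvg_id].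
  by move=> /(_ _ y0U).
have /nbhs_ballP[r r0 Hr] := N.
have r2 : 0 < r / 2 by rewrite divr_gt0.
(* A multiple of v is the difference of two directions from x into U. *)
have Uyv : U (y0 + (r / 2) *: v).
  apply: Hr; rewrite -ball_normE /= sub0r normrN gtr0_norm //.
  by rewrite ltr_pdivrMr // mulr_natr mulr2n ltrDl.
have := dir _ Uyv.
rewrite addrAC linearD (dir _ Uy0) add0r linearZ /= => /eqP.
by rewrite scaler_eq0 gt_eqF //= => /eqP.
Qed.

(** The differential does not depend on the chosen extension, hence can be
computed with whichever extension is at hand. *)
Lemma Dwithin_eq W (f g : 'rV[R]_n -> W) x v : U x ->
  smooth_extension U f x g -> Dwithin U f x v = 'd g x v.
Proof.
move=> Ux gE; rewrite /Dwithin.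
have : smooth_extension U f x (xget f (smooth_extension U f x)).
  exact: (xgetPex f (ex_intro _ g gE)).
move: (xget _ _) => g' [sg' eg']; case: gE => [sg eg].
apply/eqP; rewrite -subr_eq0; apply/eqP.
have dB := diffB (smooth_at_diff sg') (smooth_at_diff sg).
transitivity ('d (g' - g) x v); first exact: esym (congr1 (@^~ v) dB).
apply: diff_eq0_on_region => //.
  by apply: differentiableB; exact: smooth_at_diff.
apply: filterS2 eg' eg => y h1 h2 Uy.
by rewrite -[LHS]/(g' y - g y) (h1 Uy) (h2 Uy) subrr.
Qed.

End ConvexRegions.

Section DwithinT.
Variables (R : realType) (V W : normedModType R).

Lemma smooth_within_setT (f : V -> W) x :
  smooth_within setT f x -> smooth_at f x.
Proof.
move=> [g [gs gE]]; apply: near_eq_smooth_at gs.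
by apply: filterS gE => y ->.
Qed.

Lemma Dwithin_setT (f : V -> W) x v : smooth_at f x ->
  Dwithin setT f x v = 'd f x v.
Proof.
move=> fs; rewrite /Dwithin.
have : smooth_extension setT f x (xget f (smooth_extension setT f x)).
  by apply: (xgetPex f); exists f; split => //; exact: filterE.
move: (xget _ _) => g [gs gE]; apply: near_diff_eq; last exact: smooth_at_diff.
by apply: filterS gE => y; apply.
Qed.

End DwithinT.

Section Parametrizations.
Variables (R : realType) (M : manifold R) (V : normedModType R).
Implicit Types (A : set V) (phi : V -> M).

(** A local extension in the chart at phi x, together with the fact that nearby
values of phi stay in the domain of that chart, so that g determines them. *)
Lemma smooth_param_ext A phi x : smooth_param A phi -> A x ->
  exists2 g, smooth_at g x &
    \forall y \near x, A y -> source (phi x) (phi y) /\ g y = chart (phi x) (phi y).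
Proof.
move=> phis Ax; have [phic [g [gs gE]]] := phis x Ax.
exists g => //.
have N : \forall y \near x, A y -> source (phi x) (phi y).
  exact: (phic _ (near_source (source_base (phi x)))).
by apply: filterS2 N gE => y h1 h2 Ay; split; [exact: h1|exact: h2].
Qed.

End Parametrizations.

Section Tangent.
Variables (R : realType) (n : nat) (U : set 'rV[R]_n) (x : 'rV[R]_n).
Hypothesis Uc : convex_region U.
Hypothesis Ux : U x.

Lemma Dparam_cst (M : manifold R) (psi : 'rV[R]_n -> M) m v :
  (forall y, U y -> psi y = m) -> Dparam U psi x v = 0.
Proof.
move=> pm; rewrite /Dparam.
rewrite (Dwithin_eq Uc (g := cst (chart m m)) v Ux) ?diff_cst //.
split; first exact: smooth_at_cst.
by apply: filterE => y Uy; rewrite /= (pm y Uy) (pm x Ux).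
Qed.

(** Chain rule for tangent maps. The equation between phi and F \o psi is only
assumed on U, as paths end on the image of f only for points of the plot. *)
Lemma Dparam_comp (M N : manifold R) (F : M -> N) (psi : 'rV[R]_n -> M)
    (phi : 'rV[R]_n -> N) v :
  smooth_param U psi ->
  smooth_at (chart (F (psi x)) \o F \o chart_inv (psi x)) (chart (psi x) (psi x)) ->
  (forall y, U y -> phi y = F (psi y)) ->
  Dparam U phi x v = tangent_map F (psi x) (Dparam U psi x v).
Proof.
move=> psis Fs phiE; have [g gs gE] := smooth_param_ext psis Ux.
have [_ gx] := nbhs_singleton gE Ux.
have dE : Dparam U psi x v = 'd g x v.
  apply: (Dwithin_eq Uc) => //; split; first exact: gs.
  by apply: filterS gE => y h /h[].
rewrite dE /tangent_map; set A := _ \o chart_inv _ in Fs *.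
rewrite -gx in Fs *.
have AG : smooth_at (A \o g) x by exact: (smooth_at_comp (@finite_dim_row R _) gs Fs).
have ext : smooth_extension U (chart (phi x) \o phi) x (A \o g).
  split; first exact: AG.
  apply: filterS gE => y h Uy; have [sy gy] := h Uy.
  have AE z : A z = chart (F (psi x)) (F (chart_inv (psi x) z)) by [].
  apply: (etrans (AE (g y))); rewrite gy (chartK sy) -(phiE y Uy) -(phiE x Ux).
  exact: erefl.
apply: (etrans (Dwithin_eq Uc v Ux ext)).
apply: (near_diff_comp (f := g) (g := A)); first exact: filterE.
  exact: smooth_at_diff.
exact: smooth_at_diff.
Qed.

Lemma path_plot_slice (N : manifold R) (p0 : N) (Phi : 'rV[R]_n -> unit_interval R -> N) t :
  path_plot p0 U Phi -> 0 <= t <= 1 -> smooth_param U (fun y => Phi y (to_unit t)).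
Proof.
move=> [_ [s ps sP]] t01 y Uy.
have [i si it] := piece_cover ps t01.
have [c [g [gs gE]]] := sP i si (y, t) (conj Uy it : (U `*` piece s i) (y, t)).
have yt : (fun z : 'rV[R]_n => (z, t)) @ y --> (y, t).
  exact: (smooth_at_continuous (smooth_at_pair (smooth_at_id y) (smooth_at_cst t y))).
split.
  move=> P /c H; have H' : \forall z \near (y, t), (U `*` piece s i) z ->
    P (Phi z.1 (to_unit z.2)) := H.
  have H2 : \forall z \near y, (U `*` piece s i) (z, t) -> P (Phi z (to_unit t)).
    exact: (yt _ H').
  suff H3 : \forall z \near y, U z -> P (Phi z (to_unit t)) by exact: H3.
  by near=> z; move=> Uz; apply: (near H2 z).
exists (fun z => g (z, t)); split.
  exact: (smooth_at_slicel (@finite_dim_row R n) gs).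
have H : \forall z \near y, (U `*` piece s i) (z, t) ->
    g (z, t) = chart (Phi y (to_unit t)) (Phi z (to_unit t)).
  exact: (yt _ gE).
by near=> z; move=> Uz; apply: (near H z).
Unshelve. all: by end_near. Qed.

End Tangent.

(** * The first variation of the integral of a one-form along paths *)

Section Family.
Variables (R : realType) (N : manifold R) (n : nat) (U : set 'rV[R]_n).
Hypothesis Uc : convex_region U.
Variables (Phi : 'rV[R]_n -> unit_interval R -> N) (x : 'rV[R]_n).
Hypothesis Ux : U x.
Variable th : dform N 1.
Hypothesis thF : is_form th.
Local Notation mu := lebesgue_measure.
Local Notation point y t := (Phi y (to_unit t)).

Definition form_density y t := th (point y t) (fun=> velocity (Phi y) t).

(** The variation field along the path Phi x in the direction v. *)
Definition path_variation v t : 'rV[R]_(mdim N) :=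
  Dparam U (fun y => point y t) x v.

Definition exterior_density v t :=
  exterior_d th (point x t) (vcons (path_variation v t) (fun=> velocity (Phi x) t)).

Definition endpoint_term v t := th (point x t) (fun=> path_variation v t).

(** The first variation formula on the time interval [a, b], for the family
of paths Phi at the parameter x. The function F extends the integral to a
neighbourhood of x, which is what smoothness on U asks for; integrability is
included because the formula is glued from adjacent intervals. *)
Definition first_variation a b := exists F : 'rV[R]_n -> R,
  [/\ smooth_at F x,
      \forall y \near x, U y ->
        mu.-integrable `[a, b] (EFin \o form_density y) /\
        F y = \int[mu]_(t in `[a, b]) form_density y t &
      forall v, mu.-integrable `[a, b] (EFin \o exterior_density v) /\
        'd F x v = \int[mu]_(t in `[a, b]) exterior_density v t +
                   (endpoint_term v b - endpoint_term v a)].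

Lemma first_variation_cat a b c : a <= b -> b <= c ->
  first_variation a b -> first_variation b c ->
  first_variation a c.
Proof.
move=> ab bc [F [Fs FE Fd]] [G [Gs GE Gd]].
exists (fun y => F y + G y); split; first exact: smooth_atD.
  apply: filterS2 FE GE => y h1 h2 Uy.
  have [i1 ->] := h1 Uy; have [i2 ->] := h2 Uy.
  by have [i3 ->] := integrable_itv_cat ab bc i1 i2.
move=> v; have [i1 E1] := Fd v; have [i2 E2] := Gd v.
have [i3 E3] := integrable_itv_cat ab bc i1 i2; split; first exact: i3.
apply: (etrans (congr1 (@^~ v) (diffD (smooth_at_diff Fs) (smooth_at_diff Gs)))).
apply: (etrans (congr2 +%R E1 E2)).
have telescope (u w b1 b2 b3 : R) :
  u + (b2 - b1) + (w + (b3 - b2)) = u + w + (b3 - b1) by ring.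
by rewrite E3; exact: telescope.
Qed.

(** Throughout this section one chart, at p, and one smooth extension g of the
family in this chart are fixed; J is a piece of the partition and O a
neighbourhood on which everything is defined. *)
Section Chart.
Variables (p : N) (g : 'rV[R]_n * R -> 'rV[R]_(mdim N)) (O : set ('rV[R]_n * R)).
Variable J : set R.
Hypothesis Oo : open O.
Hypothesis gO : forall z, O z -> smooth_at g z /\ target p (g z).
Hypothesis gE : forall z, O z -> U z.1 -> J z.2 ->
  source p (point z.1 z.2) /\ g z = chart p (point z.1 z.2).

Let lf := local_form1 th.

Lemma near_box z : O z -> \forall z' \near z, O z'.
Proof. by move=> Oz; exact: (@open_nbhs_nbhs _ z O (conj Oo Oz)). Qed.

Lemma lift_smooth m z : O z -> source m (chart_inv p (g z)) ->
  smooth_at (chart m \o chart_inv p \o g) z.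
Proof.
move=> Oz sz; have [gs gt] := gO Oz.
apply: smooth_at_comp => //; first exact: finite_dim_row.
exact: transition_smooth_at.
Qed.

Lemma lift_diff m z w : O z -> source m (chart_inv p (g z)) ->
  'd (chart m \o chart_inv p \o g) z w =
  'd (chart m \o chart_inv p) (g z) ('d g z w).
Proof.
move=> Oz sz; have [gs gt] := gO Oz.
apply: (near_diff_comp (f := g) (g := chart m \o chart_inv p)).
- exact: filterE.
- exact: smooth_at_diff.
- exact/smooth_at_diff/transition_smooth_at.
Qed.

(** The pulled back one-form may be computed in the chart at any other point
m. Taking for m the point of the family itself centres the chart there, as in
the definitions of the velocity and of the exterior derivative. *)
Lemma lift_local_form m z w : O z -> source m (chart_inv p (g z)) ->
  lf p (g z) ('d g z w) =
  lf m ((chart m \o chart_inv p \o g) z) ('d (chart m \o chart_inv p \o g) z w).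
Proof.
move=> Oz sz; have [gs gt] := gO Oz.
apply: (etrans (local_form_transition th (fun=> 'd g z w) gt sz)).
exact: (congr1 (lf m _) (esym (lift_diff w Oz sz))).
Qed.

Lemma near_lift_source m z : O z -> source m (chart_inv p (g z)) ->
  \forall z' \near z, O z' /\ source m (chart_inv p (g z')).
Proof.
move=> Oz sz; have [gs gt] := gO Oz; apply: filterI; first exact: near_box.
have sn : \forall z' \near z, target p (g z') /\ source m (chart_inv p (g z')).
  exact: (smooth_at_continuous gs (near_chart_inv_source gt sz)).
by apply: filterS sn => z' [].
Qed.

Lemma chart_inv_point y t : O (y, t) -> U y -> J t -> chart_inv p (g (y, t)) = point y t.
Proof. by move=> Oz Uy Jt; have [/= sp ->] := gE Oz Uy Jt; rewrite chartK. Qed.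

Local Notation lift y t := (chart (point y t) \o chart_inv p \o g).

Lemma lift_source y t : O (y, t) -> U y -> J t ->
  source (point y t) (chart_inv p (g (y, t))).
Proof. by move=> Oz Uy Jt; rewrite chart_inv_point //; exact: source_base. Qed.

Lemma lift_at y t : O (y, t) -> U y -> J t ->
  lift y t (y, t) = chart (point y t) (point y t).
Proof. by move=> Oz Uy Jt; rewrite /= chart_inv_point. Qed.

Lemma form_at_point y t w : O (y, t) -> U y -> J t ->
  lf p (g (y, t)) ('d g (y, t) w) = th (point y t) (fun=> 'd (lift y t) (y, t) w).
Proof.
move=> Oz Uy Jt; apply: (etrans (lift_local_form w Oz (lift_source Oz Uy Jt))).
apply: (etrans (congr1 (fun u => lf (point y t) u ('d (lift y t) (y, t) w))
  (lift_at Oz Uy Jt))).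
apply: (etrans (local_form_chart th _ (source_base _))).
by congr (th _ _); apply/funext => i; exact: diff_chartK.
Qed.

Lemma velocity_lift y t : O (y, t) -> U y -> J t -> (\forall s \near t, J s) ->
  velocity (Phi y) t = 'd (lift y t) (y, t) (0, 1).
Proof.
move=> Oz Uy Jt Jn.
have Gs := lift_smooth Oz (lift_source Oz Uy Jt).
apply: (etrans _ (diff_slicer (smooth_at_diff Gs) 1)); apply: esym.
have Os : \forall s \near t, O (y, s).
  have c : (fun s : R => (y, s)) @ t --> (y, t).
    exact: (smooth_at_continuous (smooth_at_pair (smooth_at_cst y t) (smooth_at_id t))).
  exact: (c _ (near_box Oz)).
have E : \forall s \near t, (lift y t) (y, s) = chart (point y t) (point y s).
  near=> s; have Os' : O (y, s) by near: s.
  have Js : J s by near: s.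
  by rewrite /= chart_inv_point.
have sd := smooth_at_diff (smooth_at_slicer (@finite_dim_row R n) Gs).
have H := @near_diff_eq R R _ (fun s => (lift y t) (y, s))
  (fun s => chart (point y t) (point y s)) t 1 E sd.
exact: H.
Unshelve. all: by end_near. Qed.

Lemma path_variation_lift v t : O (x, t) -> J t ->
  path_variation v t = 'd (lift x t) (x, t) (v, 0).
Proof.
move=> Oz Jt; have Gs := lift_smooth Oz (lift_source Oz Ux Jt).
apply: (etrans _ (diff_slicel (smooth_at_diff Gs) v)).
apply: (Dwithin_eq Uc) => //; split.
  exact: (smooth_at_slicel (@finite_dim_row R n) Gs).
have Oy : \forall y \near x, O (y, t).
  have c : (fun y : 'rV[R]_n => (y, t)) @ x --> (x, t).
    exact: (smooth_at_continuous (smooth_at_pair (smooth_at_id x) (smooth_at_cst t x))).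
  exact: (c _ (near_box Oz)).
by apply: filterS Oy => y Oy Uy; rewrite /= chart_inv_point.
Qed.

(** The pointwise identity behind the first variation formula. Both
derivatives are moved to the chart centred at the point of the family, where
the exterior derivative is defined, and [pullback_exterior_d] applies. *)
Lemma lift_exterior_d v t : O (x, t) -> J t -> (\forall s \near t, J s) ->
  'd (fun z => lf p (g z) ('d g z (0, 1))) (x, t) (v, 0) -
  'd (fun z => lf p (g z) ('d g z (v, 0))) (x, t) (0, 1) = exterior_density v t.
Proof.
move=> Oz Jt Jn; set G := lift x t.
have sz := lift_source Oz Ux Jt.
have Gs : smooth_at G (x, t) by exact: lift_smooth.
have lin := local_form1_linear thF (point x t).
have sm w : smooth_at (lf (point x t) ^~ w) (G (x, t)).
  by apply: local_form1_smooth => //; exact: chart_target.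
have E w u : 'd (fun z => lf p (g z) ('d g z w)) (x, t) u =
    'd (fun z => lf (point x t) (G z) ('d G z w)) (x, t) u.
  apply: esym; apply: near_diff_eq; last first.
    apply/smooth_at_diff/(smooth_at_pairing lin Gs) => //; exact: smooth_at_deriv.
  have sn := near_lift_source Oz sz.
  apply: filterS sn => z [oz oz2].
  exact: (esym (lift_local_form w oz oz2)).
apply: (etrans (congr2 (fun a b : R => a - b) (E _ _) (E _ _))).
pose e1 : 'rV[R]_n * R := (v, 0); pose e2 : 'rV[R]_n * R := (0, 1).
have H := pullback_exterior_d lin e1 e2 Gs sm.
cbv beta; apply: (etrans H).
rewrite /exterior_density (velocity_lift Oz Ux Jt Jn) (path_variation_lift v Oz Jt).
apply: (etrans _ (esym (exterior_d1 _ _ _ _))).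
have GE : G (x, t) = chart (point x t) (point x t) := lift_at Oz Ux Jt.
by rewrite -GE.
Qed.

(** Differentiate the integral of h = theta(d_t) under the integral sign. By
[lift_exterior_d] the integrand d_v h is the exterior derivative plus the time
derivative of k = theta(d_v), and the latter integrates to the end point
terms. *)
Lemma chart_first_variation a b : a <= b ->
  (forall s, a <= s <= b -> O (x, s) /\ J s) -> first_variation a b.
Proof.
move=> ab OJ.
pose e2 : 'rV[R]_n * R := (0, 1).
have lin := local_form1_linear thF p.
have ks w z : O z -> smooth_at (fun z => lf p (g z) ('d g z w)) z.
  move=> Oz; have [gs gt] := gO Oz.
  apply: (smooth_at_pairing lin gs (smooth_at_deriv w gs)) => u.
  exact: local_form1_smooth.
pose h z := lf p (g z) ('d g z e2).
have hx : slice_smooth a b h x by move=> s /OJ[Os _]; exact: ks.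
have fd := @finite_dim_row R n.
(* Two-sided time derivatives are available at interior times only. *)
have Jn s : a < s < b -> \forall r \near s, J r.
  move=> sab; have ir : \forall r \near s, r \in `]a, b[ by exact: near_in_itvoo.
  near=> r; have : r \in `]a, b[ by near: r.
  by rewrite in_itv /= => /andP[ra rb]; apply: (OJ r _).2; rewrite !ltW.
exists (fun y => \int[mu]_(s in `[a, b]) h (y, s)); split.
- exact: smooth_at_integral.
- have : \forall y \near x, forall s, a <= s <= b -> O (y, s).
    by apply: tube_segment => s /OJ[Os _]; exact: near_box.
  apply: filterS => y Oy Uy.
  have hy : slice_smooth a b h y by move=> s /Oy; exact: ks.
  have hE s : a < s < b -> h (y, s) = form_density y s.
    move=> sab; have sab' : a <= s <= b by case/andP: sab => ? ?; rewrite !ltW.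
    have [_ Js] := OJ _ sab'; have Os := Oy _ sab'.
    apply: (etrans (form_at_point e2 Os Uy Js)).
    by rewrite /form_density (velocity_lift Os Uy Js (Jn _ sab)).
  by have [i1 ->] := integrable_oo_eq hE (slice_smooth_integrable fd hy).
move=> v; pose e1 : 'rV[R]_n * R := (v, 0).
pose k z := lf p (g z) ('d g z e1).
have kx : slice_smooth a b k x by move=> s /OJ[Os _]; exact: ks.
have i1 := slice_smooth_integrable fd (slice_smooth_deriv e1 hx).
have i2 := slice_smooth_integrable fd (slice_smooth_deriv e2 kx).
have i3 : mu.-integrable `[a, b]
    (EFin \o (fun s => 'd h (x, s) e1 - 'd k (x, s) e2)).
  exact: (integrableB _ i1 i2).
have dE s : a < s < b -> 'd h (x, s) e1 - 'd k (x, s) e2 = exterior_density v s.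
  move=> sab; have [|Os Js] := OJ s; first by case/andP: sab => ? ?; rewrite !ltW.
  exact: (lift_exterior_d v Os Js (Jn _ sab)).
have [i4 E4] := integrable_oo_eq dE i3; split; first exact: i4.
have bE s : a <= s <= b -> endpoint_term v s = k (x, s).
  move=> /OJ[Os Js]; rewrite /endpoint_term (path_variation_lift v Os Js).
  exact: (esym (form_at_point e1 Os Ux Js)).
have kE : \int[mu]_(s in `[a, b]) 'd k (x, s) e2 = k (x, b) - k (x, a).
  rewrite -(@integral_deriv R (fun s => k (x, s)) a b ab); last first.
    by move=> s /kx/(smooth_at_slicer fd).
  apply: eq_Rintegral => s; rewrite inE /= in_itv /= => sab.
  exact: (esym (diff_slicer (smooth_at_diff (kx _ sab)) 1)).
have [_ dF] := diff_integral fd ab hx.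
have EB : \int[mu]_(s in `[a, b]) exterior_density v s =
    \int[mu]_(s in `[a, b]) 'd h (x, s) e1 - \int[mu]_(s in `[a, b]) 'd k (x, s) e2.
  apply: (etrans E4).
  apply: RintegralB; [exact: measurable_itv|exact: i1|exact: i2].
apply: (etrans (congr1 (@^~ v) dF)).
rewrite EB kE !bE ?lexx ?ab //.
by rewrite subrK.
Unshelve. all: by end_near. Qed.

End Chart.

(** Around each time in a piece of the partition there is a single
extension in a single chart; the formula on [0, 1] follows by additivity. *)
Lemma path_plot_first_variation p0 : path_plot p0 U Phi -> first_variation 0 1.
Proof.
move=> [_ [s ps sP]].
apply: (partition_induction ps); first exact: first_variation_cat.
move=> i si t0 Jt0.
have [g gs gE] := smooth_param_ext (sP i si) (conj Ux Jt0 : (U `*` piece s i) (x, t0)).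
set p := Phi _ _ in gE.
have [sp0 gp0] := nbhs_singleton gE (conj Ux Jt0).
have gt : target p (g (x, t0)) by rewrite gp0; exact: chart_target.
have gtn : \forall z \near (x, t0), target p (g z).
  exact: (smooth_at_continuous gs (near_target gt)).
have /near_open[A [oA Ax AP]] : \forall z \near (x, t0),
    [/\ smooth_at g z, target p (g z) & (U `*` piece s i) z ->
      source p (Phi z.1 (to_unit z.2)) /\ g z = chart p (Phi z.1 (to_unit z.2))].
  near=> z; split; near: z; [exact: (smooth_at_near gs)|exact: gtn|exact: gE].
have /nbhs_ballP[e e0 He] : \forall t \near t0, A (x, t).
  have c : (fun t : R => (x, t)) @ t0 --> (x, t0).
    exact: (smooth_at_continuous (smooth_at_pair (smooth_at_cst x t0) (smooth_at_id t0))).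
  exact: (c _ (@open_nbhs_nbhs _ (x, t0) A (conj oA Ax))).
exists e => // a b Ja Jb ab ae be.
apply: (@chart_first_variation p g A (piece s i)) => //.
- by move=> z /AP[].
- by move=> z /AP[_ _ zE] Uz Jz; exact: zE.
move=> r /andP[ar rb]; split.
  apply: He; rewrite -ball_normE /= ltr_norml.
  move: ae be; rewrite !ltr_norml => /andP[a1 a2] /andP[b1 b2].
  by apply/andP; split; lra.
move: Ja Jb; rewrite /piece /= !in_itv /= => /andP[a1 _] /andP[_ b2].
by rewrite (le_trans a1) // (le_trans rb).
Unshelve. all: by end_near. Qed.

End Family.

(** * One-parameter curves and the plots that represent fundamental fields *)

Section SmoothCurves.
Variable R : realType.

Lemma diff_derive1 (f : R -> R) (x df v : R) :
  is_derive x 1 f df -> differentiable f x /\ 'd f x v = v * df.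
Proof.
move=> [d1 d2]; have d : differentiable f x by apply/derivable1_diffP.
split => //; rewrite -[v in LHS]mulr1 -[v * 1]/(v *: (1 : R)) linearZ.
by rewrite -deriveE // d2.
Qed.

(** The sine is used below as a smooth bounded function with derivative 1
at 0; its derivatives cycle through the cosine, hence the joint induction. *)
Lemma sin_cos_smooth k : Ck k (@sin R) setT /\ Ck k (@cos R) setT.
Proof.
have oT : open (setT : set R) by exact: openT.
elim: k => [|k [IHs IHc]].
  by split => x _; [exact: continuous_sin|exact: continuous_cos].
split; split=> [x _|v].
- by case: (diff_derive1 0 (is_derive_sin x)).
- apply: (eq_Ck (f := fun x : R => cst v x *: cos x)) => // [x _|].
    by case: (diff_derive1 v (is_derive_sin x)) => _ ->.
  by apply: CkZ => //; exact: Ck_cst.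
- by case: (diff_derive1 0 (is_derive_cos x)).
- apply: (eq_Ck (f := fun x : R => cst (- v) x *: sin x)) => // [x _|].
    by case: (diff_derive1 v (is_derive_cos x)) => _ ->; rewrite mulrN -mulNr.
  by apply: CkZ => //; exact: Ck_cst.
Qed.

Lemma bounded_reparam (r : R) : 0 < r -> exists rho : R -> R,
  [/\ forall s, smooth_at rho s, rho 0 = 0, 'd rho 0 1 = 1 & forall s, `|rho s| <= r].
Proof.
move=> r0; exists (fun s => r * sin (s / r)); split.
- move=> s; have s1 : smooth_at (fun s : R => s / r) s.
    apply: (near_eq_smooth_at (f := fun s : R => id s *: (cst r^-1 s : R))).
      exact: filterE.
    by apply: smooth_atZ; [exact: smooth_at_id|exact: smooth_at_cst].
  have s2 : smooth_at (@sin R) (s / r).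
    by exists setT; split => // [|k]; [exact: openT|exact: (sin_cos_smooth k).1].
  have s3 := smooth_at_comp (@finite_dimR R) s1 s2.
  exact: (smooth_atZ (smooth_at_cst r s) s3).
- by rewrite mul0r sin0 mulr0.
- have D : is_derive (0 : R) 1 (fun s : R => r * sin (s / r)) 1.
    have h1 : is_derive (0 : R) 1 (fun s : R => s / r) r^-1.
      have := is_deriveM (is_derive_id (0 : R) 1) (is_derive_cst r^-1 (0 : R) 1).
      by move/is_derive_eq; apply; rewrite /cst scaler0 add0r [_ *: _]mulr1.
    have h2 := @is_derive1_comp R (@sin R) (fun s : R => s / r) 0 _ _ (is_derive_sin (0 / r)) h1.
    have h3 := is_deriveZ r h2.
    apply: is_derive_eq h3 _.
    by rewrite mul0r cos0 mul1r [_ *: _]mulfV ?gt_eqF.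
  by case: (diff_derive1 1 D) => _ ->; rewrite mulr1.
move=> s; rewrite normrM (gtr0_norm r0) ler_piMr ?(ltW r0) //.
by rewrite ler_norml sin_geN1 sin_le1.
Qed.

End SmoothCurves.

Section Curves.
Variables (R : realType) (G : lie_group R) (X : lie_algebra G).

(** A straight line in the chart at 1 leaves the chart, whereas [curve] asks
for a curve on all of R; the line is reparametrized by a bounded function with
derivative 1 at 0. *)
Lemma curve_exists : exists c : R -> G,
  [/\ smooth_param [set: R] c, c 0 = lg1 G & Dparam [set: R] c 0 1 = X].
Proof.
pose z0 := chart (lg1 G) (lg1 G).
have t0 : target (lg1 G) z0 by apply: chart_target; exact: source_base.
have /nbhs_ballP[r r0 Hr] := near_target t0.
(* A reparametrization bounded by e keeps the line inside the ball of radius r. *)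
pose e := r / (`|X| + 1).
have X1 : 0 < `|X| + 1 by rewrite ltr_wpDl.
have e0 : 0 < e by rewrite divr_gt0.
have [rho [rs rho0 rho1 rle]] := bounded_reparam e0.
pose l s := z0 + rho s *: X.
have lt s : target (lg1 G) (l s).
  apply: Hr; rewrite -ball_normE /= /l opprD addrA subrr sub0r normrN normrZ.
  apply: (@le_lt_trans _ _ (e * `|X|)); first by rewrite ler_wpM2r.
  by rewrite /e mulrAC ltr_pdivrMr // ltr_pM2l // ltrDl.
have ls s : smooth_at l s.
  apply: (@smooth_atD _ _ _ (cst z0) (fun s => rho s *: cst X s)).
    exact: smooth_at_cst.
  by apply: smooth_atZ; [exact: rs|exact: smooth_at_cst].
pose c s : G := chart_inv (lg1 G) (l s).
have c0 : c 0 = lg1 G by rewrite /c /l rho0 scale0r addr0 chartK //; exact: source_base.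
(* The chart at c s is reached from the chart at 1 by a transition map. *)
have cs s : smooth_at (chart (c s) \o c) s.
  apply: (@smooth_at_comp _ _ _ _ l (chart (c s) \o chart_inv (lg1 G))) => //.
    exact: finite_dim_row.
  by apply: transition_smooth_at => //; exact: source_base.
exists c; split => //.
  move=> s _; split.
    apply: cvg_within_filter.
    apply: (@continuous_comp _ _ _ l (chart_inv (lg1 G)) s).
      exact: smooth_at_continuous.
    exact: chart_inv_continuous.
  by exists (chart (c s) \o c); split => //; exact: filterE.
rewrite /Dparam Dwithin_setT //.
have ld : 'd l 0 1 = X.
  have dr : is_diff 0 rho ('d rho 0) by apply/differentiableP/smooth_at_diff.
  have h := is_diffD (is_diff_cst z0 (0 : R))
    (is_diffZ_fun (smooth_at_diff (rs 0)) (smooth_at_diff (smooth_at_cst X (0 : R)))).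
  have [_ ->] := h.
  apply: (etrans (add0r _)).
  have [_ ->] := is_diff_cst X (0 : R).
  by rewrite rho1 scaler0 add0r scale1r.
transitivity ('d (chart (lg1 G) \o chart_inv (lg1 G)) (l 0) ('d l 0 1)).
  apply: (near_diff_comp (f := l) (g := chart (lg1 G) \o chart_inv (lg1 G))).
  - by apply: filterE => s; rewrite /= c0.
  - exact: smooth_at_diff.
  - apply/smooth_at_diff/transition_smooth_at => //; rewrite -/(c 0) c0.
    exact: source_base.
rewrite ld /l rho0 scale0r addr0; exact: diff_chartK.
Qed.

Lemma curveP : [/\ smooth_param [set: R] (curve X), curve X 0 = lg1 G &
  Dparam [set: R] (curve X) 0 1 = X].
Proof.
have [c cP] := curve_exists; rewrite /curve; set S := [set _ | _].
exact: (@xgetPex _ (fun=> lg1 G) S (ex_intro _ c cP)).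
Qed.

End Curves.

Section Actions.
Variables (R : realType) (G : lie_group R) (M : manifold R) (a : G -> M -> M).
Hypothesis act : smooth_action a.

Lemma action_id q : a (lg1 G) q = q.
Proof. by case: act => -[]. Qed.

Lemma action_chart_smooth g q :
  smooth_at (fun z : 'rV[R]_(mdim G) * 'rV[R]_(mdim M) =>
    chart (a g q) (a (chart_inv g z.1) (chart_inv q z.2))) (chart g g, chart q q).
Proof. by case: act => _ [_]; exact. Qed.

(** A slice of the smooth map (g, q) |-> g q. *)
Lemma action_smooth g q : smooth_at (chart (a g q) \o a g \o chart_inv q) (chart q q).
Proof.
have s1 : smooth_at (fun w : 'rV[R]_(mdim M) => (chart g g, w)) (chart q q).
  by apply: smooth_at_pair; [exact: smooth_at_cst|exact: smooth_at_id].
have := smooth_at_comp (finite_dim_prod (@finite_dim_row R _) (@finite_dim_row R _))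
  s1 (action_chart_smooth g q).
apply: near_eq_smooth_at; apply: filterE => w /=.
by rewrite chartK //; exact: source_base.
Qed.

Section Flow.
Variables (n : nat) (U : set 'rV[R]_n) (psi : 'rV[R]_n -> M) (x : 'rV[R]_n).
Hypothesis Uc : convex_region U.
Hypothesis psis : smooth_param U psi.
Hypothesis Ux : U x.
Variable X : lie_algebra G.

Let U' := [set z : 'rV[R]_(1 + n) | U (rsubmx z)].
Let flow (z : 'rV[R]_(1 + n)) := a (curve X (lsubmx z ord0 ord0)) (psi (rsubmx z)).

Lemma flow_region : convex_region U'.
Proof.
case: Uc => Uconv [y0 y0U]; split.
  move=> y z t Uy Uz t01; rewrite /U' /= linearD !linearZ; exact: Uconv.
exists (row_mx 0 y0); rewrite /interior /=.
have := @continuous_rsubmx R 1 1 n (row_mx 0 y0).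
by move=> /(_ U); apply; rewrite row_mxKr.
Qed.

Lemma flow0 : flow (row_mx 0 x) = psi x.
Proof.
have [_ c0 _] := curveP X.
by rewrite /flow row_mxKl row_mxKr mxE c0 action_id.
Qed.

Let time (z : 'rV[R]_(1 + n)) : R := lsubmx z ord0 ord0.

Lemma time_smooth z : smooth_at time z /\ 'd time z = time :> (_ -> _).
Proof.
have c : continuous (coordl (ord0 : 'I_1) \o lsubmx : {linear 'rV[R]_(1 + n) -> R}).
  move=> y; apply: continuous_comp; first exact: continuous_lsubmx.
  exact: coordl_continuous.
split; first exact: (smooth_at_linear z c).
exact: (diff_lin z c).
Qed.

Lemma rsubmx_smooth z : smooth_at (rsubmx : 'rV[R]_(1 + n) -> 'rV[R]_n) z /\
  'd (rsubmx : 'rV[R]_(1 + n) -> 'rV[R]_n) z = rsubmx :> (_ -> _).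
Proof.
have c : continuous (rsubmx : {linear 'rV[R]_(1 + n) -> 'rV[R]_n}).
  exact: continuous_rsubmx.
split; first exact: (smooth_at_linear z c).
exact: (diff_lin z c).
Qed.

Lemma curve_chart : smooth_at (chart (lg1 G) \o curve X) 0 /\
  'd (chart (lg1 G) \o curve X) 0 1 = X.
Proof.
have [cs c0 cX] := curveP X.
have [_ w] := cs 0 I; rewrite c0 in w.
have s := smooth_within_setT w; split; first exact: s.
rewrite /Dparam c0 in cX.
have h := Dwithin_setT (1 : R) s.
exact: (etrans (esym h) cX).
Qed.

(** In charts the plot z = (s, y) |-> c(s) psi(y) is the action read in
charts, composed with (s, y) |-> (c(s), psi(y)). Its differential therefore
splits into the orbit map, whose derivative is the fundamental field, and the
action of 1, whose derivative is the identity. *)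
Lemma Dparam_flow u : Dparam U' flow (row_mx 0 x) u =
  lsubmx u ord0 ord0 *: fundamental_field a X (psi x) + Dparam U psi x (rsubmx u).
Proof.
have [g gs gE] := smooth_param_ext psis Ux.
rewrite -/(time u); have [_ gx] := nbhs_singleton gE Ux.
have [cs c0 _] := curveP X; have [c1s c1d] := curve_chart.
set p := psi x in gE gx *.
pose A (z : 'rV[R]_(mdim G) * 'rV[R]_(mdim M)) :=
  chart p (a (chart_inv (lg1 G) z.1) (chart_inv p z.2)).
have As : smooth_at A (chart (lg1 G) (lg1 G), chart p p).
  by have := action_chart_smooth (lg1 G) p; rewrite action_id.
pose B z := ((chart (lg1 G) \o curve X) (time z), g (rsubmx z)).
pose x' : 'rV[R]_(1 + n) := row_mx 0 x.
have tx : time x' = 0 by rewrite /time row_mxKl mxE.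
have rx : rsubmx x' = x by rewrite row_mxKr.
have [ts td] := time_smooth x'; have [rs rd] := rsubmx_smooth x'.
have s1 : smooth_at (fun z => (chart (lg1 G) \o curve X) (time z)) x'.
  apply: (smooth_at_comp (@finite_dimR R) ts); rewrite tx; exact: c1s.
have s2 : smooth_at (fun z => g (rsubmx z)) x'.
  apply: (smooth_at_comp (@finite_dim_row R n) rs); rewrite rx; exact: gs.
have Bs : smooth_at B x' by exact: smooth_at_pair.
have Bx : B x' = (chart (lg1 G) (lg1 G), chart p p).
  by rewrite /B tx rx /= c0 gx.
have ABs : smooth_at (A \o B) x'.
  apply: smooth_at_comp => //; first by apply: finite_dim_prod; exact: finite_dim_row.
  by rewrite Bx.
have Ux' : U' x' by rewrite /U' /= row_mxKr.
have ext : smooth_extension U' (chart (flow x') \o flow) x' (A \o B).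
  split => //; rewrite flow0 -/p.
  have n1 : \forall z \near x', source (lg1 G) (curve X (time z)).
    have [cc _] := cs 0 I.
    have tc : {for x', continuous time} := smooth_at_continuous ts.
    rewrite /prop_for /continuous_at tx in tc.
    have sn : \forall s \near (0 : R), source (lg1 G) (curve X s).
      have N : \forall s \near (0 : R), [set: R] s -> source (lg1 G) (curve X s).
        by apply: cc; rewrite c0; apply: near_source; exact: source_base.
      near=> s; exact: (near N s).
    exact: (tc _ sn).
  have n2 : \forall z \near x', U (rsubmx z) ->
      source p (psi (rsubmx z)) /\ g (rsubmx z) = chart p (psi (rsubmx z)).
    have rc : {for x', continuous (rsubmx : 'rV[R]_(1 + n) -> 'rV[R]_n)}.
      exact: smooth_at_continuous rs.
    rewrite /prop_for /continuous_at rx in rc.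
    exact: (rc _ gE).
  near=> z; move=> Uz.
  have h1 : source (lg1 G) (curve X (time z)) by near: z.
  have [h2 h3] : source p (psi (rsubmx z)) /\ g (rsubmx z) = chart p (psi (rsubmx z)).
    by apply: (near n2 z).
  by rewrite /A /B /flow /= h3 !chartK.
rewrite /Dparam (Dwithin_eq flow_region u Ux' ext).
have dA : differentiable A (B x') by rewrite Bx; exact: smooth_at_diff.
transitivity ('d A (B x') ('d B x' u)).
  apply: (near_diff_comp (f := B) (g := A)) => //; first exact: filterE.
  exact: smooth_at_diff.
have dB : 'd B x' u = (time u *: X, 'd g x (rsubmx u)).
  apply: (etrans (congr1 (@^~ u) (diff_pair (smooth_at_diff s1) (smooth_at_diff s2)))).
  congr pair.
    transitivity ('d (chart (lg1 G) \o curve X) (time x') ('d time x' u)).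
      apply: (near_diff_comp (f := time) (g := chart (lg1 G) \o curve X)).
      - exact: filterE.
      - exact: smooth_at_diff.
      - by rewrite tx; exact: smooth_at_diff.
    rewrite td tx -[time u in LHS]mulr1 -[time u * 1]/(time u *: (1 : R)) linearZ.
    by rewrite c1d.
  transitivity ('d g (rsubmx x') ('d rsubmx x' u)).
    apply: (near_diff_comp (f := rsubmx) (g := g)).
    - exact: filterE.
    - exact: smooth_at_diff.
    - by rewrite rx; exact: smooth_at_diff.
  by rewrite rd rx.
rewrite dB Bx.
have -> : (time u *: X, 'd g x (rsubmx u)) =
    time u *: (X, 0 : 'rV[R]_(mdim M)) + (0 : 'rV[R]_(mdim G), 'd g x (rsubmx u)).
  by congr pair; rewrite /= ?addr0 ?scaler0 ?add0r.
rewrite linearD linearZ; congr (_ *: _ + _).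
  rewrite -(diff_slicel (smooth_at_diff As)) /fundamental_field /tangent_map action_id.
  congr ('d _ _ X); apply/funext => w.
  by rewrite /A /= chartK //; exact: source_base.
rewrite -(diff_slicer (smooth_at_diff As)).
have -> : Dwithin U (chart (psi x) \o psi) x (rsubmx u) = 'd g x (rsubmx u).
  apply: (Dwithin_eq Uc) => //; split => //.
  by apply: filterS gE => y h /h[].
(* The unit acts trivially, so in the second variable A is the identity. *)
have H : \forall w \near chart p p, id w = A (chart (lg1 G) (lg1 G), w).
  have tp : target p (chart p p) by apply: chart_target; exact: source_base.
  apply: filterS (near_target tp) => w tw.
  by rewrite /A /= chartK ?action_id ?chart_invK //; exact: source_base.
by have [_ ->] := near_eq_is_diff H (is_diff_id _).
Unshelve. all: by end_near. Qed.

End Flow.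

End Actions.

(** * Integrals of one-forms along single paths *)

Lemma to_unit0 (R : realType) : to_unit (0 : R) = I0 R.
Proof. by apply: val_inj; rewrite /to_unit val_insubd lexx ler01. Qed.

Lemma to_unit1 (R : realType) : to_unit (1 : R) = I1 R.
Proof. by apply: val_inj; rewrite /to_unit val_insubd lexx ler01. Qed.

Section Paths.
Variables (R : realType) (N : manifold R).
Local Notation mu := lebesgue_measure.
Implicit Types (u : unit_interval R -> N) (th : dform N 1).

Lemma to_function_eta th u : to_function (eta_pi th) u =
  \int[mu]_(t in `[0, 1]) th (u (to_unit t)) (fun=> velocity u t).
Proof.
by rewrite /to_function /eta_pi; apply: eq_Rintegral => t _; rewrite vcons_nil.
Qed.

Lemma convex_region_point : convex_region [set: 'rV[R]_0].
Proof. by split => //; exists 0; exact: filterE. Qed.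

(** A single path is a plot over the point, so that statements about plots
apply to it. *)
Lemma constant_plot p0 u : path_from p0 u ->
  path_plot p0 [set: 'rV[R]_0] (fun=> u).
Proof.
move=> pu; split; first by move=> x _; exact: pu.
case: pu => -[s ps sP] _; exists s => // i si [y t] [_ /= it].
have [c [g [gs gE]]] := sP i si t it.
have tc : (snd : 'rV[R]_0 * R -> R) @ (y, t) --> t.
  exact: (smooth_at_continuous (smooth_at_snd (y, t))).
split.
  move=> P /c H; have H' : \forall r \near t, piece s i r -> P (u (to_unit r)) := H.
  have H2 : \forall z \near (y, t), piece s i z.2 -> P (u (to_unit z.2)).
    exact: (tc _ H').
  suff H3 : \forall z \near (y, t), ([set: 'rV[R]_0] `*` piece s i) z ->
    P (u (to_unit z.2)) by exact: H3.
  by near=> z; move=> -[_ iz]; apply: (near H2 z).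
exists (g \o snd); split.
  by apply: (smooth_at_comp (@finite_dimR R)); [exact: smooth_at_snd|exact: gs].
have H : \forall z \near (y, t), piece s i z.2 ->
    g z.2 = chart (u (to_unit t)) (u (to_unit z.2)).
  exact: (tc _ gE).
by near=> z; move=> -[_ iz]; apply: (near H z).
Unshelve. all: by end_near. Qed.

(** Part of the first variation formula for the constant plot. *)
Lemma form_along_path_integrable th p0 u : is_form th -> path_from p0 u ->
  mu.-integrable `[0, 1] (EFin \o (fun t => th (u (to_unit t)) (fun=> velocity u t))).
Proof.
move=> thF /constant_plot up.
have [F [_ FE _]] := path_plot_first_variation convex_region_point (x := 0) I thF up.
by have [] := nbhs_singleton FE I.
Qed.

Section ActionOnPaths.
Variables (G : lie_group R) (a : G -> N -> N).
Hypothesis act : smooth_action a.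

Lemma velocity_action g (J : set R) u t : smooth_param J (u \o @to_unit R) -> J t ->
  (\forall s \near t, J s) ->
  velocity (a g \o u) t = tangent_map (a g) (u (to_unit t)) (velocity u t).
Proof.
move=> us Jt Jn; have [h hs hE] := smooth_param_ext us Jt.
set p := u (to_unit t) in hE *.
have [_ ht] := nbhs_singleton hE Jt.
have E : \forall s \near t, source p (u (to_unit s)) /\ h s = chart p (u (to_unit s)).
  by near=> s; apply: (near hE s) => //; near: s.
have vE : velocity u t = 'd h t 1.
  apply: esym; apply: (@near_diff_eq R R _ h (fun s => chart p (u (to_unit s)))).
    by apply: filterS E => s [].
  exact: smooth_at_diff.
rewrite vE /tangent_map.
have As := action_smooth act g p.
set A := _ \o chart_inv _ in As *.
rewrite (_ : chart p p = h t) in As *; last by rewrite ht.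
apply: (@near_diff_comp R R _ _ (fun s => chart (a g p) (a g (u (to_unit s)))) h A).
- apply: filterS E => s [sp hsE].
  by rewrite /A /= hsE chartK.
- exact: smooth_at_diff.
- exact: smooth_at_diff.
Unshelve. all: by end_near. Qed.

(** The two integrands agree only inside the pieces of the partition, so the
equality is proved piece by piece, where [integrable_oo_eq] transfers
integrability. *)
Lemma integral_action_pullback th p0 u g : is_form (pullback (a g) th) -> path_from p0 u ->
  \int[mu]_(t in `[0, 1])
    th (a g (u (to_unit t))) (fun=> velocity (a g \o u) t) =
  \int[mu]_(t in `[0, 1]) pullback (a g) th (u (to_unit t)) (fun=> velocity u t).
Proof.
move=> thF pu; have int := form_along_path_integrable thF pu.
case: pu => -[s ps sP] _.
set f := fun t => pullback (a g) th (u (to_unit t)) (fun=> velocity u t) in int *.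
set h := fun t => th (a g (u (to_unit t))) (fun=> velocity (a g \o u) t).
pose P x y := [/\ mu.-integrable `[x, y] (EFin \o f),
   mu.-integrable `[x, y] (EFin \o h) &
   \int[mu]_(t in `[x, y]) h t = \int[mu]_(t in `[x, y]) f t].
suff : P 0 1 by case.
apply: (partition_induction ps).
  move=> x y z xy yz [f1 h1 E1] [f2 h2 E2].
  have [f3 F3] := integrable_itv_cat xy yz f1 f2.
  have [h3 H3] := integrable_itv_cat xy yz h1 h2.
  by split; [exact: f3|exact: h3|rewrite F3 H3 E1 E2].
move=> i si t it; exists 1 => // x y ix iy xy _ _.
have f1 : mu.-integrable `[x, y] (EFin \o f).
  apply: integrableS int => //.
  move=> r /=; rewrite !in_itv /= => /andP[xr ry].
  have /andP[x0 _] := piece_sub01 ps si ix; have /andP[_ y1] := piece_sub01 ps si iy.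
  by rewrite (le_trans x0 xr) (le_trans ry y1).
have sub r : x < r < y -> piece s i r.
  move: ix iy; rewrite /piece /= !in_itv /= => /andP[x1 _] /andP[_ y2] /andP[xr ry].
  by rewrite (le_trans x1) ?(le_trans _ y2) // ltW.
have fh r : x < r < y -> f r = h r.
  move=> rxy; rewrite /f /h /pullback.
  rewrite (velocity_action g (sP i si) (sub r rxy)) //.
  have ir : \forall q \near r, q \in `]x, y[ by exact: near_in_itvoo.
  by apply: filterS ir => q; rewrite in_itv /=; exact: sub.
by have [h1 E1] := integrable_oo_eq fh f1.
Qed.

End ActionOnPaths.
End Paths.

(** * The momentum mapping *)

Section Alternating.
Variables (R : realType) (V : lmodType R) (w : ('I_3 -> V) -> R).
Hypothesis wa : alternating_multilinear w.

(** A cyclic permutation of three arguments is the product of two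
transpositions, and each transposition changes the sign by polarization. *)
Lemma alternating3_cycle x y z :
  w (vcons x (vcons y (fun=> z))) = w (vcons y (vcons z (fun=> x))).
Proof.
pose L b c d := w (vcons b (vcons c (fun=> d))); change (L x y z = L y z x).
have [ml alt] := wa.
pose i1 : 'I_3 := lift ord0 ord0; pose i2 : 'I_3 := lift ord0 (lift ord0 ord0).
have vE (v : 'I_3 -> V) : v = vcons (v ord0) (vcons (v i1) (fun=> v i2)).
  apply/funext => i; case: (unliftP ord0 i) => [j ->|->]; last by rewrite vcons0.
  rewrite vconsS; case: (unliftP ord0 j) => [k ->|->]; last by rewrite vcons0.
  by rewrite vconsS (ord1 k).
have v1 b c d : vcons b (vcons c (fun=> d)) i1 = c :> V by rewrite vconsS vcons0.
have v2 b c d : vcons b (vcons c (fun=> d)) i2 = d :> V by rewrite !vconsS.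
have L0 b c u v : L (u + v) b c = L u b c + L v b c.
  have E r : [eta vcons 0 (vcons b (fun=> c)) with ord0 |-> r] =
      vcons r (vcons b (fun=> c)) :> ('I_3 -> V) by rewrite [LHS]vE /= v1 v2.
  by have := ml ord0 (vcons 0 (vcons b (fun=> c))) 1 u v; rewrite scale1r mul1r !E.
have L1 b c u v : L b (u + v) c = L b u c + L b v c.
  have E r : [eta vcons b (vcons 0 (fun=> c)) with i1 |-> r] =
      vcons b (vcons r (fun=> c)) :> ('I_3 -> V) by rewrite [LHS]vE /= v2 vcons0.
  by have := ml i1 (vcons b (vcons 0 (fun=> c))) 1 u v; rewrite scale1r mul1r !E.
have L2 b c u v : L b c (u + v) = L b c u + L b c v.
  have E r : [eta vcons b (vcons c (fun=> 0)) with i2 |-> r] =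
      vcons b (vcons c (fun=> r)) :> ('I_3 -> V) by rewrite [LHS]vE /= v1 vcons0.
  by have := ml i2 (vcons b (vcons c (fun=> 0))) 1 u v; rewrite scale1r mul1r !E.
have A01 b c : L b b c = 0.
  by apply: (alt _ ord0 i1) => //; rewrite v1 vcons0.
have A12 b c : L c b b = 0.
  by apply: (alt _ i1 i2) => //; rewrite v1 v2.
have S01 b c d : L b c d = - L c b d.
  apply/eqP; rewrite -addr_eq0; apply/eqP.
  by rewrite -[RHS](A01 (b + c) d) L0 !L1 !A01 add0r addr0.
have S12 b c d : L d b c = - L d c b.
  apply/eqP; rewrite -addr_eq0; apply/eqP.
  by rewrite -[RHS](A12 (b + c) d) L1 !L2 !A12 add0r addr0.
by rewrite S01 S12 opprK.
Qed.

End Alternating.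

Lemma lgVK (R : realType) (G : lie_group R) (g : G) : lgV (lgV g) = g.
Proof.
have MV (h : G) : lgM h (lgV h) = lg1 G.
  rewrite -[LHS](lg1M) -{1}(lgVM (lgV h)) -lgMA (lgMA (lgV h)) lgVM lg1M.
  exact: lgVM.
have M1 (h : G) : lgM h (lg1 G) = h by rewrite -(lgVM h) lgMA MV lg1M.
by rewrite -[LHS]M1 -(lgVM g) lgMA lgVM lg1M.
Qed.

Lemma chen_d_function (R : realType) (Y : Type) (h : Y -> R) n U
    (phi : 'rV[R]_n -> Y) x v :
  chen_d (of_function h) U phi x v = Dwithin U (h \o phi) x (v ord0).
Proof. by rewrite /chen_d big_ord1 expr0 mul1r. Qed.

Theorem theorem4p1 (R : realType) (G : lie_group R) (M N : manifold R)
    (aM : G -> M -> M) (aN : G -> N -> N) (f : M -> N) (o : M)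
    (lam : dform N 3) (zeta : dform M 2) (theta : lie_algebra G -> dform N 1)
    (connM : connected [set: M]) (connN : connected [set: N])
    (actM : smooth_action aM) (actN : smooth_action aN)
    (f_smooth : smooth_map f)
    (f_equivariant : forall g q, f (aM g q) = aN g (f q))
    (fixed_base : forall g, aN g (f o) = f o)
    (lam_form : is_form lam) (lam_invariant : invariant_form aN lam)
    (lam_closed : closed_form lam)
    (zeta_form : is_form zeta) (zeta_invariant : invariant_form aM zeta)
    (d_zeta : exterior_d zeta = pullback f lam)
    (theta_form : forall X, is_form (theta X))
    (theta_linear : forall q v, scalar (fun X => theta X q v))
    (theta_equivariant : forall g X,
       theta (Ad g X) = pullback (aN (lgV g)) (theta X))
    (delta_lam : forall X q v,
       delta_G aN (fun=> lam) X q v = - exterior_d (theta X) q v)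
    (delta_zeta : forall X,
       delta_G aM (fun=> zeta) X = pullback f (theta X))
    (delta_theta : forall X q v, delta_G aN theta X q v = 0) :
  momentum_mapping (Y := fiber f o) (fiber_act (f := f) (o := o) aM aN)
    (zeta_fiber (f := f) (o := o) lam zeta)
    (mu_fiber (f := f) (o := o) theta).

Proof.
have muE (y : fiber f o) X : mu_fiber (f := f) (o := o) theta y X =
    - \int[lebesgue_measure]_(t in `[0, 1])
        theta X (y.2 (to_unit t)) (fun=> velocity y.2 t).
  by rewrite /mu_fiber to_function_eta.
split.
- move=> y [yp _] c X Y; rewrite !muE.
  have iX := form_along_path_integrable (theta_form X) yp.
  have iY := form_along_path_integrable (theta_form Y) yp.
  rewrite mulrN -opprD; congr (- _).
  rewrite -RintegralZl // -RintegralD //; last exact: (integrableZl _ c iX).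
  by apply: eq_Rintegral => t _; exact: theta_linear.
- move=> g y [yp _]; apply/funext => X.
  (* Equivariance of theta, read at the inverse of g. *)
  have pullE : theta (Ad (lgV g) X) = pullback (aN g) (theta X).
    by rewrite theta_equivariant lgVK.
  apply: (etrans (muE _ X)); apply: esym; apply: (etrans (muE y (Ad (lgV g) X))).
  apply: (congr1 (@GRing.opp R)); apply: esym; rewrite pullE.
  apply: (integral_action_pullback (th := theta X) actN (p0 := f o)); last exact: yp.
  by rewrite -pullE.
- move=> X n U phi Uc [_ _ plot2] x Ux.
  have [F [Fs FE _]] := path_plot_first_variation Uc Ux (theta_form X) plot2.
  exists (fun y => - F y); split; first exact: smooth_atN.
  by apply: filterS FE => y h Uy; have [_ ->] := h Uy; rewrite /= muE.
move=> X n U phi Uc [inP plot1 plot2] x v Ux; rewrite chen_d_function.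
set m : 'rV[R]_n -> M := fst \o phi in plot1.
set Phi : 'rV[R]_n -> unit_interval R -> N := snd \o phi in plot2.
set w := v ord0.
have vE : v = (fun=> w) by apply/funext => i; rewrite (ord1 i).
have [F [Fs FE /(_ w)[_ Fd]]] := path_plot_first_variation Uc Ux (theta_form X) plot2.
have -> : Dwithin U ((fun y : fiber f o => mu_fiber (f := f) (o := o) theta y X) \o phi)
    x w = - 'd F x w.
  rewrite -(diffN_fun w (smooth_at_diff Fs)); apply: (Dwithin_eq Uc) => //; split.
    exact: smooth_atN.
  by apply: filterS FE => y h Uy; have [_ ->] := h Uy; rewrite /= muE.
rewrite Fd /chen_delta_G; congr (- _).
pose x' : 'rV[R]_(1 + n) := row_mx 0 x.
(* At time 0 all paths are at f o, so there is no variation. *)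
have b0 : endpoint_term U Phi x (theta X) w 0 = 0.
  have v0 : path_variation U Phi x w 0 = 0.
    apply: (Dparam_cst (m := f o) Uc Ux) => y Uy.
    by have [[_ y0] _] := inP y Uy; rewrite to_unit0.
  rewrite /endpoint_term v0.
  have := form1_linear (theta_form X) (Phi x (to_unit 0)) 1 0 0.
  by rewrite scale1r addr0 mul1r -[LHS]addr0 => /addrI.
(* At time 1 the paths end in the image of f, and delta_G zeta = f^* theta. *)
have b1 : endpoint_term U Phi x (theta X) w 1 =
    - zeta (m x) (vcons (fundamental_field aM X (m x)) (fun=> Dparam U m x w)).
  have fE y : U y -> Phi y (to_unit 1) = f (m y).
    by move=> Uy; have [_ y1] := inP y Uy; rewrite to_unit1.
  transitivity (pullback f (theta X) (m x) (fun=> Dparam U m x w)); last first.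
    by rewrite -delta_zeta.
  rewrite /endpoint_term /pullback fE //; congr (theta X _ _); apply/funext => i.
  apply: (Dparam_comp Uc Ux) => //.
  by case: f_smooth => _; exact.
rewrite b0 subr0 b1 /zeta_fiber /chen_sub; congr (_ - _); last first.
  rewrite /chen_pullback /chen_of_form.
  rewrite (_ : (_ \o _) (row_mx 0 x) = m x); last exact: (flow0 actM m x X).
  congr (zeta _ _); apply/funext => i /=.
  rewrite (Dparam_flow actM Uc plot1 Ux X).
  case: (unliftP ord0 i) => [j ->|->].
    by rewrite !vconsS row_mxKl row_mxKr mxE scale0r add0r vE.
  rewrite !vcons0 row_mxKl row_mxKr mxE scale1r.
  by rewrite /Dparam /Dwithin linear0 addr0.
rewrite /chen_pullback /eta_pi; apply: eq_Rintegral => t; rewrite inE /= in_itv /= => t01.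
have us := path_plot_slice plot2 t01.
pose psi y := Phi y (to_unit t).
(* The path component of the plot that defines the contraction. *)
pose Psi (z : 'rV[R]_(1 + n)) (r : unit_interval R) : N :=
  aN (curve X (lsubmx z ord0 ord0)) (Phi (rsubmx z) r).
have PsiE : Psi x' = Phi x.
  by apply/funext => r; exact: (flow0 actN (fun y => Phi y r) x X).
apply: esym; change (lam (Psi x' (to_unit t)) (vcons (velocity (Psi x') t)
  (Dparam [set z | U (rsubmx z)] (fun z => Psi z (to_unit t)) x' \o
     vcons (row_mx (const_mx 1) 0) (fun i => row_mx 0 (v i)))) =
  exterior_density U Phi x (theta X) w t).
rewrite PsiE /exterior_density.
have := delta_lam X (psi x) (vcons (path_variation U Phi x w t) (fun=> velocity (Phi x) t)).
(* The identity for delta_G lam: d theta_X is the contraction of lam with X_N. *)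
rewrite /delta_G => /oppr_inj <-.
(* The operator eta puts the velocity into the first slot. *)
rewrite -(alternating3_cycle (lam_form.1 _)).
congr (lam _ _); apply/funext => i.
case: (unliftP ord0 i) => [j ->|->]; last by rewrite !vcons0.
rewrite !vconsS /= (Dparam_flow actN Uc us Ux X).
case: (unliftP ord0 j) => [k ->|->].
  by rewrite !vconsS row_mxKl row_mxKr mxE scale0r add0r vE.
rewrite !vcons0 row_mxKl row_mxKr mxE scale1r.
by rewrite /Dparam /Dwithin linear0 addr0.
Qed.
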